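(* Let $X$ be a path connected, locally path connected and semi-locally simply connected topological space. The monodromy functor $$\mathrm{Cov}(X)\to \mathrm{Func}(\pi(X),\mathbf{Set}),\qquad (p\colon Y\to X)\mapsto F(p),$$ and the functor $$\mathrm{Func}(\pi(X),\mathbf{Set})\to \mathrm{Cov}(X),\qquad F\mapsto (p(F)\colon Y(F)\to X),$$ are category isomorphisms.
   Context: A covering map is a continuous surjective map $p\colon Y\to X$ such that for every $x\in X$ there are a neighborhood $U$ of $x$, a discrete set $S$, and a homeomorphism $U\times S\to p^{-1}(U)$ whose composite with $p$ is the projection $U\times S\to U$. $\mathrm{Cov}(X)$ is the category whose objects are the covering maps $Y\to X$ and whose morphisms from $p_1\colon Y_1\to X$ to $p_2\colon Y_2\to X$ are the continuous maps $f\colon Y_1\to Y_2$ with $p_1=p_2f$. Two categories $\mathcal C$ and $\mathcal D$ are isomorphic when there are functors $\mathcal C\to\mathcal D$ and $\mathcal D\to\mathcal C$ such that the composite functors are the respective identity functors (they are equivalent when the composites are only naturally isomorphic to the identity functors). $\pi(X)$ is the fundamental groupoid of $X$: its objects are the points of $X$, its morphisms $x_1\to x_2$ form the set $\pi(X)(x_1,x_2)$ of homotopy classes (relative to end points) of paths from $x_1$ to $x_2$, and composition is the product of paths, where $uv$ means first $u$, then $v$. Functors $F\colon\pi(X)\to\mathbf{Set}$ into the category of sets satisfy $F(uv)=F(v)\circ F(u)$ for $u\in\pi(X)(x_0,x_1)$, $v\in\pi(X)(x_1,x_2)$. $\mathrm{Func}(\pi(X),\mathbf{Set})$ is the category of such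 functors, with natural transformations as morphisms. The monodromy functor $F(p)\colon\pi(X)\to\mathbf{Set}$ of a covering map $p\colon Y\to X$ takes $x\in X$ to the fibre $p^{-1}(x)$ and takes $[u]\in\pi(X)(x_0,x_1)$ to the map $p^{-1}(x_0)\to p^{-1}(x_1)$, $y\mapsto y\cdot[u]=\widetilde u_y(1)$, where $\widetilde u_y$ is the unique lift of $u$ starting at $y$. A morphism $f$ from $p_1$ to $p_2$ in $\mathrm{Cov}(X)$ is taken to the natural transformation with components $f|p_1^{-1}(x)\colon p_1^{-1}(x)\to p_2^{-1}(x)$. $X$ is semi-locally simply connected if for every point $x\in X$ any neighborhood of $x$ contains a neighborhood $U$ of $x$ such that any loop at $x$ in $U$ is contractible in $X$. For a functor $F\colon\pi(X)\to\mathbf{Set}$, $Y(F)=\bigcup_{x\in X}F(x)$ is the union of the fibres $F(x)$ and $p(F)\colon Y(F)\to X$ is the obvious map taking $F(x)$ to $x$ for every $x\in X$. The topology on $Y(F)$ has as basis the sets $(U,y)=\{F(u_z)(y)\mid z\in U\}$, where $x\in X$, $U$ is an open path connected neighborhood of $x$ such that any loop in $U$ based at $x$ is nullhomotopic in $X$, $y\in F(x)$, and $u_z\in\pi(X)(x,z)$ is the unique path homotopy class of paths in $U$ from $x$ to $z$. A natural transformation $\tau\colon F_1\Rightarrow F_2$ is taken to the map $Y(F_1)\to Y(F_2)$ over $X$ that is $\tau_x$ on $F_1(x)$.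
   Formalization: Functors F are required to have pairwise disjoint values F(x), so that p(F) is defined and F(p(F))=F; since the empty functor gives a non-surjective map, the claim is proved for nonempty-valued functors, and for all disjoint-valued ones with surjectivity of coverings dropped. *)

(* Defs.v *)
From HB Require Import structures.
From mathcomp Require Import all_boot all_order all_algebra generic_quotient.
From mathcomp Require Import boolp classical_sets functions.
From mathcomp Require Import reals topology normedtype homotopy.
From mathcomp Require Import lra.
Set Implicit Arguments.
Unset Strict Implicit.
Unset Printing Implicit Defensive.
Import Order.TTheory GRing.Theory Num.Theory numFieldNormedType.Exports.
Local Open Scope classical_set_scope.
Local Open Scope ring_scope.
Local Open Scope quotient_scope.

(* Composition is written in diagrammatic order: [comp f g] is [f] followed by
   [g], so that the product of paths is the composition of the fundamental
   groupoid. *)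

Record category := Category {
  ob :> Type;
  hom : ob -> ob -> Type;
  idm : forall a, hom a a;
  comp : forall a b c, hom a b -> hom b c -> hom a c;
  comp_idl : forall a b (f : hom a b), comp (idm a) f = f;
  comp_idr : forall a b (f : hom a b), comp f (idm b) = f;
  comp_assoc : forall a b c d (f : hom a b) (g : hom b c) (h : hom c d),
    comp f (comp g h) = comp (comp f g) h }.

Arguments hom {_}.
Arguments idm {_}.
Arguments comp {_ _ _ _}.

Record functor (C D : category) := Functor {
  fob :> C -> D;
  fmap : forall a b : C, hom a b -> hom (fob a) (fob b);
  fmap_id : forall a : C, fmap (idm a) = idm (fob a);
  fmap_comp : forall (a b c : C) (f : hom a b) (g : hom b c),
    fmap (comp f g) = comp (fmap f) (fmap g) }.

Arguments fmap {C D} _ {a b}.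

Definition functor_id (C : category) : functor C C :=
  @Functor C C (fun a => a) (fun a b f => f)
    (fun=> erefl) (fun _ _ _ _ _ => erefl).

Section functor_comp.
Context (C D E : category) (F : functor C D) (G : functor D E).

Let fc_ob (a : C) : E := G (F a).
Let fc_map (a b : C) (f : hom a b) : hom (fc_ob a) (fc_ob b) :=
  fmap G (fmap F f).

Lemma functor_comp_subproof1 (a : C) : fc_map (idm a) = idm (fc_ob a).
Proof. by rewrite /fc_map !fmap_id. Qed.

Lemma functor_comp_subproof2 (a b c : C) (f : hom a b) (g : hom b c) :
  fc_map (comp f g) = comp (fc_map f) (fc_map g).
Proof. by rewrite /fc_map !fmap_comp. Qed.

(* [F] first, then [G] *)
Definition functor_comp : functor C E :=
  Functor functor_comp_subproof1 functor_comp_subproof2.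

End functor_comp.

Definition mutually_inverse (C D : category) (F : functor C D)
    (G : functor D C) : Prop :=
  functor_comp F G = functor_id C /\ functor_comp G F = functor_id D.

Record natural_transformation (C D : category) (F G : functor C D) := NatTrans {
  component :> forall a : C, hom (F a) (G a);
  naturality : forall (a b : C) (f : hom a b),
    comp (fmap F f) (component b) = comp (component a) (fmap G f) }.

Lemma natural_transformation_eq (C D : category) (F G : functor C D)
    (s t : natural_transformation F G) : (forall a, s a = t a) -> s = t.
Proof.
case: s t => [s s_nat] [t t_nat] /= st.
have E : s = t by apply: functional_extensionality_dep.
by subst t; rewrite (Prop_irrelevance s_nat t_nat).
Qed.

Section functor_category.
Context (C D : category).

Lemma nat_id_subproof (F : functor C D) (a b : C) (f : hom a b) :
  comp (fmap F f) (idm (F b)) = comp (idm (F a)) (fmap F f).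
Proof. by rewrite comp_idl comp_idr. Qed.

Definition nat_id (F : functor C D) : natural_transformation F F :=
  NatTrans (@nat_id_subproof F).

Lemma nat_comp_subproof (F G H : functor C D) (s : natural_transformation F G)
    (t : natural_transformation G H) (a b : C) (f : hom a b) :
  comp (fmap F f) (comp (s b) (t b)) = comp (comp (s a) (t a)) (fmap H f).
Proof. by rewrite comp_assoc naturality -comp_assoc naturality comp_assoc. Qed.

Definition nat_comp (F G H : functor C D) (s : natural_transformation F G)
    (t : natural_transformation G H) : natural_transformation F H :=
  NatTrans (nat_comp_subproof s t).

Program Definition functor_category : category :=
  @Category (functor C D) (@natural_transformation C D) nat_id nat_comp _ _ _.
Next Obligation.
by move=> F G s; apply: natural_transformation_eq => a; exact: comp_idl.
Qed.
Next Obligation.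
by move=> F G s; apply: natural_transformation_eq => a; exact: comp_idr.
Qed.
Next Obligation.
move=> F G H K s t u.
by apply: natural_transformation_eq => a; exact: comp_assoc.
Qed.

End functor_category.

Section full_subcategory.
Context (C : category) (P : C -> Prop).

Program Definition full_subcategory : category :=
  @Category {a : C | P a} (fun a b => hom (sval a) (sval b))
    (fun a => idm (sval a)) (fun a b c f g => comp f g) _ _ _.
Next Obligation. by move=> *; exact: comp_idl. Qed.
Next Obligation. by move=> *; exact: comp_idr. Qed.
Next Obligation. by move=> *; exact: comp_assoc. Qed.

End full_subcategory.

(* Rocq types do not admit the strict equalities of sets that an isomorphism of
   categories requires: the fibre of the projection of a sigma type is in
   bijection with the summand, but it is not equal to it as a type. So a set is
   a set of elements of a type [U], with extensional equality, and statements
   about the category of sets are made for every [U]. *)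
Program Definition sets (U : Type) : category :=
  @Category (set U) (fun A B => A -> B) (fun A => idfun)
    (fun A B C f g => g \o f) _ _ _.
Solve Obligations with by [].

Section unit_interval.
Context (R : realType).

Definition unit_interval : Type := set_type (`[0, 1]%classic : set R).

HB.instance Definition _ := Topological.on unit_interval.

Definition unit_val (t : unit_interval) : R := \val t.

Lemma unit_val_inj : injective unit_val.
Proof. exact: val_inj. Qed.

Lemma in_unit_interval (t : R) : 0 <= t <= 1 -> t \in (`[0, 1]%classic : set R).
Proof. by move=> t01; apply/mem_set; rewrite /= in_itv. Qed.

Definition clamp (t : R) : R := Num.max 0 (Num.min t 1).

Lemma clamp_itv (t : R) : 0 <= clamp t <= 1.
Proof.
by rewrite /clamp le_max lexx /= ge_max ler01 /= ge_min lexx orbT.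
Qed.

Definition to_unit (t : R) : unit_interval :=
  exist _ (clamp t) (in_unit_interval (clamp_itv t)).

Lemma unit_val_itv (t : unit_interval) : 0 <= unit_val t <= 1.
Proof.
by have := set_valP t; rewrite /= in_itv.
Qed.

Lemma clampE (t : R) : 0 <= t <= 1 -> clamp t = t.
Proof. by case/andP=> t0 t1; rewrite /clamp min_l // max_r. Qed.

Lemma to_unitE (t : R) : 0 <= t <= 1 -> unit_val (to_unit t) = t.
Proof. exact: clampE. Qed.

Lemma unit_valK (t : unit_interval) : to_unit (unit_val t) = t.
Proof. by apply: unit_val_inj; rewrite /unit_val /= clampE // unit_val_itv. Qed.

Lemma unit_zero_neq_one : to_unit 0 != to_unit 1.
Proof.
apply/eqP => /(congr1 unit_val); rewrite !to_unitE ?lexx ?ler01 //.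
by move/eqP; rewrite eq_sym oner_eq0.
Qed.

HB.instance Definition _ :=
  isBiPointed.Build unit_interval unit_zero_neq_one.

Lemma unit_val0 : unit_val zero = 0.
Proof. by rewrite /zero /unit_val /= clampE // lexx ler01. Qed.

Lemma unit_val1 : unit_val one = 1.
Proof. by rewrite /one /unit_val /= clampE // lexx ler01. Qed.

Lemma continuous_unit_val : continuous unit_val.
Proof. exact: initial_continuous. Qed.

Lemma continuous_maxr (T : topologicalType) (f g : T -> R) :
  continuous f -> continuous g -> continuous (fun t => Num.max (f t) (g t)).
Proof. by move=> cf cg t; apply: continuous_max; [exact: cf|exact: cg]. Qed.

Lemma continuous_minr (T : topologicalType) (f g : T -> R) :
  continuous f -> continuous g -> continuous (fun t => Num.min (f t) (g t)).
Proof. by move=> cf cg t; apply: continuous_min; [exact: cf|exact: cg]. Qed.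

Lemma continuous_to_unit : continuous to_unit.
Proof.
move=> t A [B [[C oC <-] Ct BA]].
have clamp_cts : {for t, continuous clamp}.
  have cmin : continuous (fun z : R => Num.min z (1 : R)).
    apply: (@continuous_minr _ (fun z => z) (fun=> 1)) => z; first exact: cvg_id.
    exact: cvg_cst.
  have c0 : continuous (fun _ : R => 0 : R) by move=> z; exact: cvg_cst.
  exact: (continuous_maxr c0 cmin).
have N : nbhs t (clamp @^-1` C).
  by apply: clamp_cts; apply: open_nbhs_nbhs; split.
by apply: (filterS _ N) => z Cz; apply: BA.
Qed.

End unit_interval.

Section homotopy.
Context (R : realType) (X : topologicalType).
Local Notation I := (unit_interval R).

Definition path_homotopic (x y : X) (u v : {path I from x to y}) : Prop :=
  exists H : I * I -> X, [/\ continuous H,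
    forall t, H (t, zero) = u t, forall t, H (t, one) = v t,
    forall s, H (zero, s) = x & forall s, H (one, s) = y].

Lemma if_continuous (T : topologicalType) (c : T -> R) (f g : T -> X) :
  continuous c -> continuous f -> continuous g ->
  (forall t, c t = 2^-1 -> f t = g t) ->
  continuous (fun t => if c t <= 2^-1 then f t else g t).
Proof.
move=> cc cf cg fg t A /=; case: ltgtP => [ct|ct|ct] At.
- have N : nbhs t (c @^-1` [set r | r < 2^-1]) by apply: cc; exact: lt_nbhsl.
  have Nf : nbhs t (f @^-1` A) by exact: cf.
  by apply: (filterS _ (filterI N Nf)) => s [/= /ltW ->].
- have N : nbhs t (c @^-1` [set r | 2^-1 < r]) by apply: cc; exact: lt_nbhsr.
  have Ng : nbhs t (g @^-1` A) by exact: cg.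
  by apply: (filterS _ (filterI N Ng)) => s [/= clt Ag]; rewrite leNgt clt.
- have Nf : nbhs t (f @^-1` A) by exact: cf.
  have Ng : nbhs t (g @^-1` A) by apply: cg; rewrite -fg.
  by apply: (filterS _ (filterI Nf Ng)) => s [/= Af Ag]; case: ifP.
Qed.

Lemma continuous_path_param (T : topologicalType) (x y : X)
    (u : {path I from x to y}) (c : T -> R) :
  continuous c -> continuous (fun t => u (to_unit (c t))).
Proof.
move=> cc t; apply: (@continuous_comp _ _ _ c (u \o @to_unit R)); first exact: cc.
apply: continuous_comp; [exact: continuous_to_unit|exact: cts_fun].
Qed.

Lemma continuous_val1 : continuous (fun p : I * I => unit_val p.1 : R).
Proof.
by move=> p; apply: continuous_comp; [exact: cvg_fst|exact: continuous_unit_val].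
Qed.

Lemma continuous_val2 : continuous (fun p : I * I => unit_val p.2 : R).
Proof.
by move=> p; apply: continuous_comp; [exact: cvg_snd|exact: continuous_unit_val].
Qed.

Lemma continuous_affine (T : topologicalType) (c : T -> R) (a b : R) :
  continuous c -> continuous (fun t => a * c t + b).
Proof.
move=> cc t; apply: cvgD; last exact: cvg_cst.
by apply: cvgM; [exact: cvg_cst|exact: cc].
Qed.

Lemma continuous_scale (T : topologicalType) (c : T -> R) (a : R) :
  continuous c -> continuous (fun t => a * c t).
Proof. by move=> cc t; apply: cvgM; [exact: cvg_cst|exact: cc]. Qed.

Lemma continuous_const (T : topologicalType) (r : R) :
  continuous (fun _ : T => r).
Proof. by move=> t; exact: cvg_cst. Qed.

Lemma to_unit_le0 (t : R) : t <= 0 -> to_unit t = zero.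
Proof.
move=> t0; apply: unit_val_inj; rewrite unit_val0 /unit_val /= /clamp.
by rewrite max_l // ge_min t0.
Qed.

Lemma to_unit_ge1 (t : R) : 1 <= t -> to_unit t = one.
Proof.
move=> t1; apply: unit_val_inj; rewrite unit_val1 /unit_val /= /clamp min_r // max_r //.
Qed.

Lemma to_unit_half1 : to_unit (2 * 2^-1 + 0 : R) = one.
Proof. by rewrite to_unit_ge1 //; lra. Qed.

Lemma to_unit_half0 : to_unit (2 * 2^-1 + - 1 : R) = zero.
Proof. by rewrite to_unit_le0 //; lra. Qed.

Lemma to_unit00 : to_unit (2 * 0 + 0 : R) = zero.
Proof. by rewrite to_unit_le0 //; lra. Qed.

Lemma to_unit11 : to_unit (2 * 1 + - 1 : R) = one.
Proof. by rewrite to_unit_ge1 //; lra. Qed.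

Lemma le0_half : 0 <= 2^-1 :> R. Proof. by lra. Qed.

Lemma le1_half : (1 <= 2^-1 :> R) = false.
Proof. by apply/negbTE; rewrite -ltNge; lra. Qed.

Section concatenation.
Context (x y z : X) (u : {path I from x to y}) (v : {path I from y to z}).

Definition concat_fun (t : I) : X :=
  if unit_val t <= 2^-1 then u (to_unit (2 * unit_val t))
  else v (to_unit (2 * unit_val t - 1)).

Lemma concat_fun_continuous : continuous concat_fun.
Proof.
apply: if_continuous; first exact: continuous_unit_val.
- by apply: continuous_path_param; apply: continuous_scale;
    exact: continuous_unit_val.
- apply: continuous_path_param; apply: continuous_affine.
  exact: continuous_unit_val.
- move=> t ->; rewrite mulfV ?pnatr_eq0 // subrr to_unit_ge1 // to_unit_le0 //.
  by rewrite path_zero path_one.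
Qed.

Lemma concat_fun_zero : concat_fun zero = x.
Proof.
by rewrite /concat_fun unit_val0 invr_ge0 ler0n mulr0 to_unit_le0 // path_zero.
Qed.

Lemma concat_fun_one : concat_fun one = z.
Proof.
rewrite /concat_fun unit_val1 ifN; last by rewrite -ltNge; lra.
by rewrite to_unit_ge1 ?path_one //; lra.
Qed.

Definition concat : {path I from x to z} :=
  mk_path concat_fun_continuous concat_fun_zero concat_fun_one.

Lemma concatE (t : I) : concat t = concat_fun t.
Proof. by []. Qed.

Lemma concat_le (t : I) : unit_val t <= 2^-1 ->
  concat t = u (to_unit (2 * unit_val t)).
Proof. by rewrite concatE /concat_fun => ->. Qed.

Lemma concat_gt (t : I) : 2^-1 < unit_val t ->
  concat t = v (to_unit (2 * unit_val t - 1)).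
Proof. by rewrite concatE /concat_fun leNgt => ->. Qed.

End concatenation.

Lemma path_homotopic_refl (x y : X) (u : {path I from x to y}) :
  path_homotopic u u.
Proof.
exists (fun p => u p.1); split=> // [p|s|s]; rewrite ?path_zero ?path_one //.
by apply: continuous_comp; [exact: cvg_fst|exact: cts_fun].
Qed.

Lemma pair_continuous (T A B : topologicalType) (f : T -> A) (g : T -> B) :
  continuous f -> continuous g -> continuous (fun t => (f t, g t)).
Proof. by move=> cf cg t; apply: cvg_pair; [exact: cf|exact: cg]. Qed.

Lemma homotopy_param (H : I * I -> X) (T : topologicalType) (a b : T -> R) :
  continuous H -> continuous a -> continuous b ->
  continuous (fun t => H (to_unit (a t), to_unit (b t))).
Proof.
move=> cH ca cb t.
apply: (@continuous_comp _ _ _ (fun t => (to_unit (a t), to_unit (b t))) H);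
  last exact: cH.
by apply: pair_continuous => {}t; apply: continuous_comp;
  [exact: ca|exact: continuous_to_unit|exact: cb|exact: continuous_to_unit].
Qed.

Lemma path_homotopic_sym (x y : X) (u v : {path I from x to y}) :
  path_homotopic u v -> path_homotopic v u.
Proof.
move=> [H [cH Hu Hv Hx Hy]].
exists (fun p => H (to_unit (unit_val p.1), to_unit (- 1 * unit_val p.2 + 1))).
split=> [|t|t|s|s] /=; rewrite ?unit_valK //.
- apply: homotopy_param => //; first exact: continuous_val1.
  by apply: continuous_affine; exact: continuous_val2.
- by rewrite unit_val0 to_unit_ge1 //; lra.
- by rewrite unit_val1 to_unit_le0 //; lra.
Qed.

Lemma path_homotopic_trans (x y : X) (u v w : {path I from x to y}) :
  path_homotopic u v -> path_homotopic v w -> path_homotopic u w.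
Proof.
move=> [H [cH Hu Hv Hx Hy]] [K [cK Kv Kw Kx Ky]].
exists (fun p => if unit_val p.2 <= 2^-1
  then H (to_unit (unit_val p.1), to_unit (2 * unit_val p.2 + 0))
  else K (to_unit (unit_val p.1), to_unit (2 * unit_val p.2 + - 1))).
split=> [|t|t|s|s] /=; rewrite ?unit_valK //.
- apply: if_continuous; first exact: continuous_val2.
  + apply: homotopy_param => //; first exact: continuous_val1.
    by apply: continuous_affine; exact: continuous_val2.
  + apply: homotopy_param => //; first exact: continuous_val1.
    by apply: continuous_affine; exact: continuous_val2.
  + by move=> [t s] /= ->; rewrite to_unit_half1 to_unit_half0 Hv Kv.
- by rewrite unit_val0 le0_half to_unit00 Hu.
- by rewrite unit_val1 le1_half to_unit11 Kw.
- by case: ifP.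
- by case: ifP.
Qed.

Lemma concat_homotopic (x y z : X) (u u' : {path I from x to y})
    (v v' : {path I from y to z}) :
  path_homotopic u u' -> path_homotopic v v' ->
  path_homotopic (concat u v) (concat u' v').
Proof.
move=> [H [cH Hu Hu' Hx Hy]] [K [cK Kv Kv' Ky Kz]].
exists (fun p => if unit_val p.1 <= 2^-1
  then H (to_unit (2 * unit_val p.1 + 0), to_unit (unit_val p.2))
  else K (to_unit (2 * unit_val p.1 + - 1), to_unit (unit_val p.2))).
split=> [|t|t|s|s] /=; rewrite ?unit_valK //.
- apply: if_continuous; first exact: continuous_val1.
  + apply: homotopy_param => //; last exact: continuous_val2.
    by apply: continuous_affine; exact: continuous_val1.
  + apply: homotopy_param => //; last exact: continuous_val2.
    by apply: continuous_affine; exact: continuous_val1.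
  + by move=> [t s] /= ->; rewrite to_unit_half1 to_unit_half0 Hy Ky.
- by rewrite addr0 Hu Kv.
- by rewrite addr0 Hu' Kv'.
- by rewrite unit_val0 le0_half to_unit00 Hx.
- by rewrite unit_val1 le1_half to_unit11 Kz.
Qed.

Lemma path_homotopic_param (x y x' y' : X) (u v : {path I from x to y})
    (w : {path I from x' to y'}) (a b : I -> R) :
  continuous a -> continuous b ->
  a zero = b zero -> a one = b one ->
  (forall t, u t = w (to_unit (a t))) -> (forall t, v t = w (to_unit (b t))) ->
  path_homotopic u v.
Proof.
move=> ca cb ab0 ab1 uE vE.
exists (fun p => w (to_unit (a p.1 + unit_val p.2 * (b p.1 - a p.1)))).
split=> [|t|t|s|s] /=.
- apply: continuous_path_param => p.
  have ca1 : {for p, continuous (fun p : I * I => a p.1)}.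
    by apply: continuous_comp; [exact: cvg_fst|exact: ca].
  have cb1 : {for p, continuous (fun p : I * I => b p.1)}.
    by apply: continuous_comp; [exact: cvg_fst|exact: cb].
  apply: cvgD; first exact: ca1.
  by apply: cvgM; [exact: continuous_val2|apply: cvgB; [exact: cb1|exact: ca1]].
- by rewrite unit_val0 mul0r addr0 uE.
- by rewrite unit_val1 mul1r addrC subrK vE.
- by rewrite ab0 subrr mulr0 addr0 -vE path_zero.
- by rewrite ab1 subrr mulr0 addr0 -vE path_one.
Qed.

Lemma concat_cst_l (x y : X) (u : {path I from x to y}) :
  path_homotopic (concat (cst x) u) u.
Proof.
apply: (@path_homotopic_param _ _ _ _ _ _ u
  (fun t => Num.max 0 (2 * unit_val t + - 1)) (fun t => unit_val t)).
- apply: continuous_maxr; first exact: continuous_const.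
  by apply: continuous_affine; exact: continuous_unit_val.
- exact: continuous_unit_val.
- by rewrite unit_val0 max_l //; lra.
- by rewrite unit_val1 max_r; lra.
- move=> t; rewrite concatE /concat_fun /=; case: ifPn => [t2|].
    by rewrite max_l ?(to_unit_le0 (lexx 0)) ?path_zero //; lra.
  rewrite -ltNge => t2; by rewrite max_r //; lra.
- by move=> t; rewrite unit_valK.
Qed.

Lemma concat_cst_r (x y : X) (u : {path I from x to y}) :
  path_homotopic (concat u (cst y)) u.
Proof.
apply: (@path_homotopic_param _ _ _ _ _ _ u
  (fun t => Num.min 1 (2 * unit_val t + 0)) (fun t => unit_val t)).
- apply: continuous_minr; first exact: continuous_const.
  by apply: continuous_affine; exact: continuous_unit_val.
- exact: continuous_unit_val.
- by rewrite unit_val0 min_r //; lra.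
- by rewrite unit_val1 min_l; lra.
- move=> t; rewrite concatE /concat_fun /=; case: ifPn => [t2|].
    by rewrite min_r addr0 //; lra.
  rewrite -ltNge => t2; by rewrite min_l ?(to_unit_ge1 (lexx 1)) ?path_one //; lra.
- by move=> t; rewrite unit_valK.
Qed.

Lemma concatA (x y z w : X) (a : {path I from x to y})
    (b : {path I from y to z}) (c : {path I from z to w}) :
  path_homotopic (concat a (concat b c)) (concat (concat a b) c).
Proof.
apply: (@path_homotopic_param _ _ _ _ _ _ (concat a (concat b c))
  (fun t => unit_val t)
  (fun t => Num.min (2 * unit_val t + 0)
     (Num.min (1 * unit_val t + 4^-1) (2^-1 * unit_val t + 2^-1)))).
- exact: continuous_unit_val.
- apply: continuous_minr.
    by apply: continuous_affine; exact: continuous_unit_val.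
  by apply: continuous_minr; apply: continuous_affine; exact: continuous_unit_val.
- by rewrite unit_val0 min_l // ?le_min; lra.
- by rewrite unit_val1 [X in Num.min _ X]min_r ?min_r; lra.
- by move=> t; rewrite unit_valK.
- move=> t; have /andP[t0 t1] := unit_val_itv t.
  have [t2|t2] := lerP (unit_val t) 2^-1; last first.
    rewrite (concat_gt _ _ t2).
    have -> : Num.min (2 * unit_val t + 0) (Num.min (1 * unit_val t + 4^-1)
        (2^-1 * unit_val t + 2^-1)) = 2^-1 * unit_val t + 2^-1.
      by rewrite [X in Num.min _ X]min_r ?min_r //; lra.
    set m := 2^-1 * unit_val t + 2^-1.
    have Em : unit_val (to_unit m) = m.
      by rewrite to_unitE // /m; apply/andP; split; lra.
    have E : 2 * m - 1 = unit_val t by rewrite /m; lra.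
    have h : 2^-1 < unit_val (to_unit m) by rewrite Em /m; lra.
    by rewrite (concat_gt _ _ h) Em E unit_valK (concat_gt _ _ t2).
  rewrite (concat_le _ _ t2).
  have E2 : unit_val (to_unit (2 * unit_val t)) = 2 * unit_val t.
    by rewrite to_unitE //; apply/andP; split; lra.
  have [t4|t4] := lerP (unit_val t) 4^-1.
    have -> : Num.min (2 * unit_val t + 0) (Num.min (1 * unit_val t + 4^-1)
        (2^-1 * unit_val t + 2^-1)) = 2 * unit_val t + 0.
      by rewrite min_l // le_min; apply/andP; split; lra.
    rewrite addr0.
    have h : unit_val (to_unit (2 * unit_val t)) <= 2^-1 by rewrite E2; lra.
    by rewrite !(concat_le _ _ h).
  have -> : Num.min (2 * unit_val t + 0) (Num.min (1 * unit_val t + 4^-1)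
      (2^-1 * unit_val t + 2^-1)) = unit_val t + 4^-1.
    by rewrite mul1r [X in Num.min _ X]min_l ?min_r //; lra.
  set m := unit_val t + 4^-1.
  have Em : unit_val (to_unit m) = m.
    by rewrite to_unitE // /m; apply/andP; split; lra.
  have Em1 : unit_val (to_unit (2 * m - 1)) = 2 * m - 1.
    by rewrite to_unitE // /m; apply/andP; split; lra.
  have E : 2 * (2 * m - 1) = 2 * (2 * unit_val t) - 1 by rewrite /m; lra.
  have h1 : 2^-1 < unit_val (to_unit m) by rewrite Em /m; lra.
  have h2 : unit_val (to_unit (2 * m - 1)) <= 2^-1 by rewrite Em1 /m; lra.
  have h3 : 2^-1 < unit_val (to_unit (2 * unit_val t)) by rewrite E2; lra.
  by rewrite (concat_gt _ _ h1) Em (concat_le _ _ h2) Em1 (concat_gt _ _ h3) E2 E.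
Qed.

Definition homotopy_rel (x y : X) : rel {path I from x to y} :=
  fun u v => `[< path_homotopic u v >].

Lemma homotopy_rel_refl (x y : X) : reflexive (@homotopy_rel x y).
Proof. by move=> u; apply/asboolP; exact: path_homotopic_refl. Qed.

Lemma homotopy_rel_sym (x y : X) : symmetric (@homotopy_rel x y).
Proof.
by move=> u v; apply/asboolP/asboolP; exact: path_homotopic_sym.
Qed.

Lemma homotopy_rel_trans (x y : X) : transitive (@homotopy_rel x y).
Proof.
move=> v u w /asboolP uv /asboolP vw; apply/asboolP.
exact: path_homotopic_trans uv vw.
Qed.

Canonical homotopy_equiv (x y : X) : equiv_rel {path I from x to y} :=
  EquivRel (@homotopy_rel x y) (@homotopy_rel_refl x y)
    (@homotopy_rel_sym x y) (@homotopy_rel_trans x y).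

Definition path_class (x y : X) : Type := {eq_quot (homotopy_equiv x y)}.

Definition class_of (x y : X) (u : {path I from x to y}) : path_class x y :=
  \pi_({eq_quot (homotopy_equiv x y)}) u.

Lemma class_of_eq (x y : X) (u v : {path I from x to y}) :
  class_of u = class_of v <-> path_homotopic u v.
Proof. by split=> [/eqmodP/asboolP|uv]//; apply/eqmodP/asboolP. Qed.

Definition class_repr (x y : X) (a : path_class x y) : {path I from x to y} :=
  repr (a : {eq_quot (homotopy_equiv x y)}).

Lemma class_reprK (x y : X) : cancel (@class_repr x y) (@class_of x y).
Proof. exact: reprK. Qed.

Definition class_concat (x y z : X) (a : path_class x y) (b : path_class y z) :
    path_class x z :=
  class_of (concat (class_repr a) (class_repr b)).

Lemma class_concatE (x y z : X) (u : {path I from x to y})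
    (v : {path I from y to z}) :
  class_concat (class_of u) (class_of v) = class_of (concat u v).
Proof.
by apply/class_of_eq/concat_homotopic; apply/class_of_eq; rewrite class_reprK.
Qed.

Program Definition fundamental_groupoid : category :=
  @Category X path_class (fun x => class_of (cst x)) class_concat _ _ _.
Next Obligation.
move=> x y a; rewrite -[a]class_reprK class_concatE.
by apply/class_of_eq; exact: concat_cst_l.
Qed.
Next Obligation.
move=> x y a; rewrite -[a]class_reprK class_concatE.
by apply/class_of_eq; exact: concat_cst_r.
Qed.
Next Obligation.
move=> x y z w a b c.
rewrite -[a]class_reprK -[b]class_reprK -[c]class_reprK !class_concatE.
by apply/class_of_eq; exact: concatA.
Qed.

Definition path_connected_space : Prop :=
  forall x y : X, exists u : {path I from x to y}, True.

Definition path_connected_set (V : set X) : Prop :=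
  forall x y : X, V x -> V y ->
    exists u : {path I from x to y}, range u `<=` V.

Definition locally_path_connected : Prop :=
  forall (x : X) (N : set X), nbhs x N ->
    exists V : set X, [/\ nbhs x V, V `<=` N & path_connected_set V].

Definition loops_contractible (x : X) (V : set X) : Prop :=
  forall u : {path I from x to x}, range u `<=` V -> path_homotopic u (cst x).

Definition semilocally_simply_connected : Prop :=
  forall (x : X) (N : set X), nbhs x N ->
    exists V : set X, [/\ nbhs x V, V `<=` N & loops_contractible x V].

End homotopy.

Definition homeomorphism (A B : topologicalType) (h : A -> B) : Prop :=
  continuous h /\ exists g : B -> A, [/\ continuous g, cancel h g & cancel g h].

Definition locally_trivial (Y X : topologicalType) (p : Y -> X) : Prop :=
  forall x : X, exists (V : set X) (S : discreteTopologicalType)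
    (h : V * S -> p @^-1` V),
    [/\ nbhs x V, homeomorphism h & forall z, p (\val (h z)) = \val z.1].

Definition covering_map (Y X : topologicalType) (p : Y -> X) : Prop :=
  [/\ continuous p, forall x, exists y, p y = x & locally_trivial p].

Section spaces_over.
Context (X : topologicalType) (U : Type).

(* The topology is given by its open sets, and not by a [topologicalType],
   because the latter also carries a choice operator, which the equality of
   spaces must not see. *)
Record space_over := SpaceOver {
  carrier : set U;
  opens : set (set (set_type carrier));
  opensT : opens setT;
  opensI : forall A B, opens A -> opens B -> opens (A `&` B);
  opens_bigcup : forall D : set (set (set_type carrier)),
    D `<=` opens -> opens (\bigcup_(A in D) A);
  proj : set_type carrier -> X }.

Definition total_space (Y : space_over) : Type := set_type (carrier Y).

HB.instance Definition _ (Y : space_over) := gen_eqMixin (total_space Y).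
HB.instance Definition _ (Y : space_over) := gen_choiceMixin (total_space Y).

Lemma opens_bigcup_family (Y : space_over) (J : Type)
    (f : J -> set (total_space Y)) :
  (forall j, opens (f j)) -> opens (\bigcup_j f j).
Proof.
move=> fo; have -> : \bigcup_j f j = \bigcup_(A in range f) A.
  by rewrite bigcup_image.
by apply: opens_bigcup => _ [j _ <-]; exact: fo.
Qed.

HB.instance Definition _ (Y : space_over) :=
  isOpenTopological.Build (total_space Y) (@opensT Y) (@opensI Y)
    (@opens_bigcup_family Y).

Lemma openE_total_space (Y : space_over) (A : set (total_space Y)) :
  open A = opens A.
Proof. by []. Qed.

Definition projection (Y : space_over) : total_space Y -> X := @proj Y.

Record map_over (Y1 Y2 : space_over) := MapOver {
  map_fun :> total_space Y1 -> total_space Y2;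
  map_continuous : continuous map_fun;
  map_proj : forall y, projection (map_fun y) = projection y }.

Lemma map_over_eq (Y1 Y2 : space_over) (f g : map_over Y1 Y2) :
  (forall y, f y = g y) -> f = g.
Proof.
case: f g => [f fc fp] [g gc gp] /= fg.
have E : f = g by apply: functional_extensionality_dep.
by subst g; rewrite (Prop_irrelevance fc gc) (Prop_irrelevance fp gp).
Qed.

Program Definition map_over_id (Y : space_over) : map_over Y Y :=
  @MapOver Y Y idfun _ _.
Next Obligation. by move=> Y y; exact: cvg_id. Qed.
Next Obligation. by []. Qed.

Program Definition map_over_comp (Y1 Y2 Y3 : space_over) (f : map_over Y1 Y2)
  (g : map_over Y2 Y3) : map_over Y1 Y3 := @MapOver Y1 Y3 (g \o f) _ _.
Next Obligation.
move=> Y1 Y2 Y3 f g y.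
by apply: continuous_comp; [exact: map_continuous|exact: map_continuous].
Qed.
Next Obligation. by move=> Y1 Y2 Y3 f g y; rewrite /= !map_proj. Qed.

Program Definition spaces_over : category :=
  @Category space_over map_over map_over_id map_over_comp _ _ _.
Solve Obligations with by move=> *; exact: map_over_eq.

End spaces_over.

Section functors.
Context (R : realType) (X : topologicalType) (U : Type).
Local Notation I := (unit_interval R).
Local Notation Pi := (fundamental_groupoid R X).
Local Notation set_functor := (functor Pi (sets U)).

Definition fibre (F : set_functor) (x : X) : set U := F x.

Definition transport (F : set_functor) (x y : X) (u : {path I from x to y}) :
    fibre F x -> fibre F y :=
  fmap F (class_of u : @hom Pi x y).
Arguments transport F {x y} u a.

Definition is_lift (Y : space_over X U) (u : I -> X) (y : total_space Y)
    (v : I -> total_space Y) : Prop :=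
  [/\ continuous v, v zero = y & forall t, projection (v t) = u t].

Definition monodromy_of (Y : space_over X U) (F : set_functor) : Prop :=
  (forall x, fibre F x = [set \val y | y in @projection _ _ Y @^-1` [set x]]) /\
  (forall (x0 x1 : X) (u : {path I from x0 to x1}) (a : fibre F x0)
     (y : total_space Y), \val y = \val a ->
     exists2 v, unique (is_lift u y) v &
       \val (transport F u a) = \val (v one)).

Definition admissible (x : X) (V : set X) : Prop :=
  [/\ open V, V x, path_connected_set R V & loops_contractible R x V].

(* The basic set (V, a). For [V] admissible all the paths [u] in [V] from [x] to
   [z] are homotopic. *)
Definition sheet (F : set_functor) (Y : space_over X U) (x : X) (V : set X)
    (a : fibre F x) : set (total_space Y) :=
  [set w | exists (z : X) (u : {path I from x to z}),
     range u `<=` V /\ \val w = \val (transport F u a)].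
Arguments sheet F Y {x} V a.

Definition sheets (F : set_functor) (Y : space_over X U) :
    set (set (total_space Y)) :=
  [set B | exists (x : X) (V : set X) (a : fibre F x),
     admissible x V /\ B = sheet F Y V a].
Arguments sheets F Y _ : clear implicits.

Definition union_of (F : set_functor) (Y : space_over X U) : Prop :=
  [/\ carrier Y = \bigcup_x fibre F x,
      forall (x : X) (y : total_space Y),
        fibre F x (\val y) -> projection y = x &
      @opens _ _ Y = [set \bigcup_(B in D) B | D in subset^~ (sheets F Y)]].

Section on_subcategories.
Context (P : spaces_over X U -> Prop)
  (Q : functor_category Pi (sets U) -> Prop).
Local Notation CP := (full_subcategory P).
Local Notation CQ := (full_subcategory Q).

Definition is_monodromy_functor (M : functor CP CQ) : Prop :=
  (forall Y : CP, monodromy_of (sval Y) (sval (M Y))) /\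
  (forall (Y1 Y2 : CP) (f : map_over (sval Y1) (sval Y2)) (x : X)
     (a : fibre (sval (M Y1)) x) (y : total_space (sval Y1)),
     \val y = \val a ->
     \val ((fmap M (f : hom Y1 Y2) : natural_transformation _ _) x a) =
     \val (f y)).

Definition is_union_functor (E : functor CQ CP) : Prop :=
  (forall F : CQ, union_of (sval F) (sval (E F))) /\
  (forall (F1 F2 : CQ) (s : natural_transformation (sval F1) (sval F2)) (x : X)
     (a : fibre (sval F1) x) (y : total_space (sval (E F1))),
     \val y = \val a ->
     \val ((fmap E (s : hom F1 F2) : map_over _ _) y) = \val (s x a)).

End on_subcategories.

(* The obvious map from the union of the sets [F x] to [X] exists only if these
   sets are pairwise disjoint, as the fibres of a map are. The lemmas on
   [disjoint_copy] below show that this is no loss of generality. *)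
Definition disjoint_values (F : set_functor) : Prop :=
  trivIset setT (fibre F).

(* A functor with empty values corresponds to the empty space over [X], which
   is locally trivial, but whose projection is not surjective if [X] is
   nonempty. *)
Definition nonempty_values (F : set_functor) : Prop :=
  forall x, fibre F x !=set0.

End functors.

Section disjoint_copy.
Context (R : realType) (X : topologicalType) (U : Type).
Local Notation Pi := (fundamental_groupoid R X).
Context (F : functor Pi (sets U)).

Let copy (x : X) : set (X * U) := [set (x, a) | a in fibre F x].

Lemma copy_subproof (x : X) (a : fibre F x) : (x, \val a) \in copy x.
Proof. by apply/mem_set; exists (\val a) => //; exact: set_valP. Qed.

Let to_copy (x : X) (a : fibre F x) : copy x :=
  exist (fun p => p \in copy x) _ (copy_subproof a).

Lemma of_copy_subproof (x : X) (b : copy x) : (\val b).2 \in fibre F x.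
Proof. by apply/mem_set; have [a Fa <-] := set_valP b. Qed.

Let of_copy (x : X) (b : copy x) : fibre F x :=
  exist (fun a => a \in fibre F x) _ (of_copy_subproof b).

Lemma to_copyK (x : X) : cancel (@to_copy x) (@of_copy x).
Proof. by move=> a; apply: val_inj. Qed.

Lemma of_copyK (x : X) : cancel (@of_copy x) (@to_copy x).
Proof.
by move=> b; apply: val_inj => /=; have [a Fa <-] := set_valP b.
Qed.

Program Definition disjoint_copy : functor Pi (sets (X * U)) :=
  @Functor Pi (sets (X * U)) copy
    (fun x y m b => to_copy ((fmap F m : fibre F x -> fibre F y) (of_copy b)))
    _ _.
Next Obligation.
by move=> x; apply: funext => b; rewrite fmap_id /= of_copyK.
Qed.
Next Obligation.
by move=> x y z m n; apply: funext => b; rewrite fmap_comp /= to_copyK.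
Qed.

Lemma disjoint_copy_disjoint : disjoint_values disjoint_copy.
Proof. by move=> x y _ _ [_ [[a _ <-] [b _ [<- _]]]]. Qed.

Definition disjoint_copy_iso (x : X) :
  fibre F x -> fibre disjoint_copy x := @to_copy x.

Lemma disjoint_copy_iso_bij (x : X) : bijective (@disjoint_copy_iso x).
Proof. by exists (@of_copy x); [exact: to_copyK|exact: of_copyK]. Qed.

Lemma disjoint_copy_iso_natural (x y : X) (m : hom (x : Pi) y) (a : fibre F x) :
  disjoint_copy_iso ((fmap F m : fibre F x -> fibre F y) a) =
  (fmap disjoint_copy m : fibre disjoint_copy x -> fibre disjoint_copy y)
    (disjoint_copy_iso a).
Proof. by rewrite /= to_copyK. Qed.

End disjoint_copy.

(* Main.v *)
Require Import Defs.
From mathcomp Require Import all_boot all_order all_algebra.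
From mathcomp Require Import boolp classical_sets reals topology.
From mathcomp Require Import functions normedtype homotopy lra.
(* Imported again because mathcomp has its own [hom] and [fmap]. *)
Require Import Defs.
Set Implicit Arguments.
Unset Strict Implicit.
Unset Printing Implicit Defensive.
Import Order.TTheory GRing.Theory Num.Theory numFieldNormedType.Exports.
Local Open Scope classical_set_scope.
Local Open Scope ring_scope.

(* Lifts of paths exist and are unique, and lifting a homotopy one path at a
   time gives an end point that depends continuously on the parameter while
   staying in a fibre; by uniqueness of lifts it is constant, so the monodromy
   functor is well defined. Call a space Y over X and a functor F associated if
   F is the monodromy of Y and Y is the union of the values of F. Each of the
   two conditions implies the other: over an admissible V the sheets (V, a) are
   the images of the local sections of Y, and the lift of u from a is
   t |-> F(u|[0,t])(a). Each condition determines Y from F or F from Y, and the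
   maps of associated objects correspond bijectively because both are
   determined by their values on the points. So association is the graph of an
   isomorphism of categories. *)

(** * Isomorphisms of categories from bijective correspondences *)

Definition arrow (C : category) : Type := {ab : C * C & hom ab.1 ab.2}.

Definition arrow_of (C : category) (a b : C) (f : hom a b) : arrow C :=
  existT (fun ab : C * C => hom ab.1 ab.2) (a, b) f.

Lemma arrow_of_inj (C : category) (a b : C) : injective (@arrow_of C a b).
Proof.
move=> f g fg; rewrite -[RHS](projT2_eq fg).
by rewrite (Prop_irrelevance (projT1_eq fg) erefl).
Qed.

Lemma functor_eq (C D : category) (F G : functor C D) :
  (forall (a b : C) (f : hom a b), arrow_of (fmap F f) = arrow_of (fmap G f)) ->
  F = G.
Proof.
move=> FG; have FGob : fob F = fob G.
  apply/funext => a.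
  by have /(congr1 (fun f => (projT1 f).1)) := FG a a (idm a).
case: F G FGob FG => [F0 F1 Fid Fcomp] [G0 G1 Gid Gcomp] /= FGob.
subst G0 => FG.
have FG1 : F1 = G1.
  do 3 apply: functional_extensionality_dep => ?.
  exact/arrow_of_inj/FG.
subst G1.
by rewrite (Prop_irrelevance Fid Gid) (Prop_irrelevance Fcomp Gcomp).
Qed.

Section category_correspondence.
Context (C D : category) (RO : C -> D -> Prop).
Context (RH : forall (a b : C) (c d : D), hom a b -> hom c d -> Prop).
Hypothesis RO_total : forall a, exists c, RO a c.
Hypothesis RO_surj : forall c, exists a, RO a c.
Hypothesis RO_fun : forall a c c', RO a c -> RO a c' -> c = c'.
Hypothesis RO_inj : forall a a' c, RO a c -> RO a' c -> a = a'.
Hypothesis RH_total : forall a b c d, RO a c -> RO b d ->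
  forall f : hom a b, exists g : hom c d, RH f g.
Hypothesis RH_surj : forall a b c d, RO a c -> RO b d ->
  forall g : hom c d, exists f : hom a b, RH f g.
Hypothesis RH_fun : forall a b c d, RO a c -> RO b d ->
  forall (f : hom a b) (g g' : hom c d), RH f g -> RH f g' -> g = g'.
Hypothesis RH_inj : forall a b c d, RO a c -> RO b d ->
  forall (f f' : hom a b) (g : hom c d), RH f g -> RH f' g -> f = f'.
Hypothesis RH_id : forall a c, RO a c -> RH (idm a) (idm c).
Hypothesis RH_comp : forall a b c a' b' c' (f : hom a b) (g : hom b c)
  (f' : hom a' b') (g' : hom b' c'), RO a a' -> RO b b' -> RO c c' ->
  RH f f' -> RH g g' -> RH (comp f g) (comp f' g').

Arguments RH_fun {a b c d}.
Arguments RH_inj {a b c d}.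
Arguments RO_inj {a a' c}.
Arguments RO_fun {a c c'}.
Arguments RH_id {a c}.
Arguments RH_comp {a b c a' b' c' f g f' g'}.

Let M0 a := sval (cid (RO_total a)).
Let M0P a : RO a (M0 a) := svalP (cid (RO_total a)).
Let M1 a b (f : hom a b) := sval (cid (RH_total (M0P a) (M0P b) f)).
Let M1P a b (f : hom a b) : RH f (M1 f) :=
  svalP (cid (RH_total (M0P a) (M0P b) f)).
Arguments M1P {a b}.
Let E0 c := sval (cid (RO_surj c)).
Let E0P c : RO (E0 c) c := svalP (cid (RO_surj c)).
Let E1 c d (g : hom c d) := sval (cid (RH_surj (E0P c) (E0P d) g)).
Let E1P c d (g : hom c d) : RH (E1 g) g :=
  svalP (cid (RH_surj (E0P c) (E0P d) g)).
Arguments E1P {c d}.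

Lemma correspondence_isomorphism : exists (M : functor C D) (E : functor D C),
  [/\ forall a, RO a (M a),
      forall a b (f : hom a b), RH f (fmap M f),
      forall c, RO (E c) c,
      forall c d (g : hom c d), RH (fmap E g) g &
      mutually_inverse M E].
Proof.
have M1id a : M1 (idm a) = idm (M0 a).
  exact: RH_fun (M0P _) (M0P _) _ _ _ (M1P _) (RH_id (M0P a)).
have M1comp a b c (f : hom a b) (g : hom b c) :
    M1 (comp f g) = comp (M1 f) (M1 g).
  apply: RH_fun (M0P _) (M0P _) _ _ _ (M1P _) _.
  exact: RH_comp (M0P _) (M0P _) (M0P _) (M1P _) (M1P _).
have E1id a : E1 (idm a) = idm (E0 a).
  exact: RH_inj (E0P _) (E0P _) _ _ _ (E1P _) (RH_id (E0P a)).
have E1comp a b c (f : hom a b) (g : hom b c) :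
    E1 (comp f g) = comp (E1 f) (E1 g).
  apply: RH_inj (E0P _) (E0P _) _ _ _ (E1P _) _.
  exact: RH_comp (E0P _) (E0P _) (E0P _) (E1P _) (E1P _).
exists (Functor M1id M1comp), (Functor E1id E1comp); split=> //; split.
  apply: functor_eq => a b f.
  have /= := E1P (M1 f).
  move: (E0P (M0 a)) (E0P (M0 b)) (E1 (M1 f)).
  move: (E0 (M0 a)) (E0 (M0 b)) => a' b' aa' bb' f' f'P.
  have e := RO_inj aa' (M0P a); have e' := RO_inj bb' (M0P b); subst a' b'.
  by congr arrow_of; apply: RH_inj f'P (M1P f).
apply: functor_eq => a b f.
have /= := M1P (E1 f).
move: (M0P (E0 a)) (M0P (E0 b)) (M1 (E1 f)).
move: (M0 (E0 a)) (M0 (E0 b)) => a' b' aa' bb' f' f'P.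
have e := RO_fun aa' (E0P a); have e' := RO_fun bb' (E0P b); subst a' b'.
by congr arrow_of; apply: RH_fun f'P (E1P f).
Qed.

End category_correspondence.

(** * Local sections *)

Lemma interval_induction (R : realType) (P : R -> R -> Prop) (a b : R) :
  a <= b ->
  (forall x y z, a <= x -> x <= y -> y <= z -> z <= b ->
     P x y -> P y z -> P x z) ->
  (forall t, a <= t <= b -> exists2 N : set R, nbhs t N &
     forall x y, a <= x <= t -> t <= y <= b ->
       (forall s, x <= s <= y -> N s) -> P x y) ->
  P a b.
Proof.
move=> ab Ptrans Ploc.
have Pball t : a <= t <= b -> exists2 e : R, 0 < e &
    forall x y, a <= x <= t -> t <= y <= b -> t - e < x -> y < t + e -> P x y.
  move=> tab; have [N /nbhs_ballP[e /= e0 eN] NP] := Ploc t tab.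
  exists e => // x y xt ty tx yt; apply: NP => // s sxy.
  by apply: eN; rewrite /ball /= ltr_distlC; apply/andP; split; lra.
pose E := [set y | a <= y <= b /\ P a y].
have Ea : E a.
  split; first by rewrite lexx.
  have [|e e0 Pe] := Pball a; first by rewrite lexx.
  by apply: Pe; rewrite ?lexx ?ab //; lra.
have Eb : ubound E b by move=> y [/andP[]].
have ubE : has_ubound E by exists b.
set s := sup E.
have sab : a <= s <= b.
  apply/andP; split; first exact: ub_le_sup.
  by apply: ge_sup => //; exists a.
have [e e0 Pe] := Pball s sab.
have [y [yab Pay] sy] : exists2 y, E y & s - e < y.
  by apply: sup_adherent => //; split; [exists a|exists b].
have ys : y <= s by apply: ub_le_sup.
pose z := Num.min b (s + e / 2).
have [as_ sb] := andP sab; have [ay yb] := andP yab.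
have sz : s <= z by rewrite /z le_min sb; lra.
have zb : z <= b by rewrite /z ge_min lexx.
have az : a <= z by exact: le_trans sz.
have Ez : E z.
  split; first by rewrite az.
  apply: (Ptrans a y z) => //; first exact: le_trans sz.
  apply: Pe => //; rewrite ?ay ?sz //.
  by rewrite /z gt_min; apply/orP; right; lra.
have zs : z <= s by apply: ub_le_sup.
have <- : z = b.
  by move: zs; rewrite /z; case: (leP b (s + e / 2)) => // h1 h2; lra.
by case: Ez.
Qed.

Lemma nbhs_subtype (T : topologicalType) (A : set T) (x : A) (B : set A) :
  nbhs x B <-> \forall y \near \val x, forall Ay : y \in A, B (exist _ y Ay).
Proof.
split=> [[C [[D oD <-] Dx DB]]|].
  apply: (filterS _ (open_nbhs_nbhs (conj oD Dx))) => y Dy Ay.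
  exact: DB.
move=> N; have : nbhs (\val x) [set y | forall Ay : y \in A, B (exist _ y Ay)].
  exact: N.
rewrite nbhsE => -[D [oD Dx] DB].
exists ((\val : A -> T) @^-1` D); split=> //; first by exists D.
by move=> [y Ay] Dy; exact: DB.
Qed.

Lemma continuous_near (S T : topologicalType) (f : S -> T) (x : S)
    (P : T -> Prop) :
  {for x, continuous f} -> (\forall y \near f x, P y) ->
  \forall x' \near x, P (f x').
Proof. by move=> fc Px; exact: fc Px. Qed.

Section sections_of_a_map.
Context (Y X : topologicalType) (p : Y -> X).

(* [sec y z] is the point over [z] on the sheet through [y] over the open set
   [V]: a trivialization without reference to a discrete set. *)
Definition local_sections (V : set X) (sec : Y -> X -> Y) : Prop :=
  open V /\ forall y, V (p y) ->
    [/\ sec y (p y) = y,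
        forall z, V z -> p (sec y z) = z,
        forall z, V z -> {for z, continuous (sec y)},
        forall z z', V z -> V z' -> sec (sec y z) z' = sec y z' &
        \forall y' \near y, V (p y') /\ forall z, V z -> sec y' z = sec y z].

Definition has_local_sections : Prop :=
  forall x, exists (V : set X) sec, V x /\ local_sections V sec.

Lemma locally_trivial_sections :
  continuous p -> locally_trivial p -> has_local_sections.
Proof.
move=> pc lt x; have [V [S [h [Vx [hc [g [gc hg gh]]] ph]]]] := lt x.
pose sec y z := match pselect (V (p y)), pselect (V z) with
  | left Vy, left Vz => \val (h (exist _ z (mem_set Vz),
      (g (exist _ y (mem_set Vy : y \in p @^-1` V))).2))
  | _, _ => y end.
have gE (w : p @^-1` V) : \val (g w).1 = p (\val w) by rewrite -ph gh.
have secE y z (Vy : y \in p @^-1` V) (Vz : z \in V) :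
    sec y z = \val (h (exist _ z Vz, (g (exist _ y Vy)).2)).
  rewrite /sec; case: pselect => [Vy'|]; last by case; exact: set_mem Vy.
  case: pselect => [Vz'|]; last by case; exact: set_mem Vz.
  congr (\val (h (exist _ z _, (g (exist _ y _)).2)));
    exact: bool_irrelevance.
have VV z : V° z -> V z by exact: interior_subset.
exists V°, sec; split=> //; split; first exact: open_interior.
move=> y Vpy; have Vy : y \in p @^-1` V by exact/mem_set/VV.
have Vin z : V° z -> z \in V by move=> /VV/mem_set.
have Vsec z : V° z -> sec y z \in p @^-1` V.
  move=> Vz; rewrite (secE _ _ Vy (Vin _ Vz)); exact: valP.
have gsec z (Vz : V° z) w : \val w = sec y z -> (g w).2 = (g (exist _ y Vy)).2.
  rewrite (secE _ _ Vy (Vin _ Vz)) => /val_inj ->; by rewrite hg.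
split.
- rewrite (secE _ _ Vy (Vin _ Vpy)); set w := exist _ y Vy.
  suff -> : (exist _ (p y) (Vin _ Vpy), (g w).2) = g w by rewrite gh.
  rewrite [RHS]surjective_pairing; congr pair.
  by apply: val_inj; rewrite /= gE.
- by move=> z Vz; rewrite (secE _ _ Vy (Vin _ Vz)) ph.
- move=> z Vz A /=; rewrite (secE _ _ Vy (Vin _ Vz)) => hA.
  set c := (g _).2 in hA.
  have kc : continuous (fun z' : V => \val (h (z', c))).
    move=> z'; apply: (@continuous_comp _ _ _ (fun z' : V => h (z', c))).
      apply: (@continuous_comp _ _ _ (fun z' : V => (z', c)) h); last exact: hc.
      apply: (@pair_continuous V V S (fun z' => z') (fun=> c)) => z''.
        exact: cvg_id.
      exact: cst_continuous.
    exact: initial_continuous.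
  have /nbhs_subtype/= := kc _ _ hA.
  move=> k.
  have /filterI/(_ k) := open_nbhs_nbhs (conj (@open_interior _ V) Vz).
  apply: filterS => z' [Vz' Az'] /=.
  by rewrite (secE _ _ Vy (Vin _ Vz')); exact: Az'.
- move=> z z' Vz Vz'.
  rewrite (secE _ _ (Vsec _ Vz) (Vin _ Vz')) (secE _ _ Vy (Vin _ Vz')).
  by congr (\val (h (_, _))); exact: (gsec z).
- have N : nbhs (exist _ y Vy : p @^-1` V)
      [set w : p @^-1` V | (g w).2 = (g (exist _ y Vy)).2].
    have k : continuous (fun w => (g w).2).
      move=> w; apply: (@continuous_comp _ _ _ g snd); first exact: gc.
      exact: cvg_snd.
    apply: (k _ [set (g (exist _ y Vy)).2]).
    by rewrite nbhs_principalE; exact/principal_filterP.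
  have pV : nbhs y (p @^-1` V°).
    by apply: pc; apply: open_nbhs_nbhs; split => //; exact: open_interior.
  move/nbhs_subtype: N => /filterI/(_ pV); apply: filterS => y' [gy' Vy'].
  have Vy'' : y' \in p @^-1` V by exact/mem_set/VV.
  split=> // z Vz; rewrite (secE _ _ Vy (Vin _ Vz)) (secE _ _ Vy'' (Vin _ Vz)).
  by congr (\val (h (_, _))); exact: gy'.
Qed.

Lemma sections_locally_trivial :
  continuous p -> has_local_sections -> locally_trivial p.
Proof.
move=> pc loc x; have [V [sec [Vx [oV secP]]]] := loc x.
pose S : discreteTopologicalType := discrete_topology (p @^-1` [set x]).
have pS (s : S) : p (\val s) = x by exact: (set_valP (s : p @^-1` [set x])).
have VS (s : S) : V (p (\val s)) by rewrite pS.
have hV (q : V * S) : sec (\val q.2) (\val q.1) \in p @^-1` V.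
  apply/mem_set => /=; have [_ psec _ _ _] := secP _ (VS q.2).
  by rewrite psec; exact: (set_valP q.1).
have gS (w : p @^-1` V) : sec (\val w) x \in p @^-1` [set x].
  apply/mem_set => /=; have [_ psec _ _ _] := secP _ (set_valP w).
  exact: psec.
have gV (w : p @^-1` V) : p (\val w) \in V.
  by apply/mem_set; exact: (set_valP w).
exists V, S, (fun q => SigSub (hV q)); split.
- exact: open_nbhs_nbhs.
- split.
    move=> [z s] A /nbhs_subtype/= NA.
    have [_ _ sc _ _] := secP _ (VS s).
    have N : nbhs (\val z) (sec (\val s) @^-1` (fun y =>
        forall Ay : y \in p @^-1` V, A (SigSub Ay))) := sc _ (set_valP z) _ NA.
    exists ([set z' : V | forall Ay : sec (\val s) (\val z') \in p @^-1` V,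
      A (SigSub Ay)], [set s]).
      split=> /=; last by rewrite nbhs_principalE; exact/principal_filterP.
      apply/nbhs_subtype; apply: filterS N => z' N' Vz' /=.
      exact: N'.
    by move=> [z' s'] /= [N' ->]; exact: N'.
  exists (fun w => (SigSub (gV w),
    SigSub (gS w) : S)); split.
  + apply: (@pair_continuous _ V S (fun w => SigSub (gV w))
      (fun w => SigSub (gS w) : S)) => w A.
      move=> /nbhs_subtype/= NA; apply/nbhs_subtype.
      by apply: filterS (continuous_near (pc _) NA) => y' N' Vy' /=; exact: N'.
    rewrite nbhs_principalE => /principal_filterP As; apply/nbhs_subtype.
    have [_ _ _ _ loc_cst] := secP _ (set_valP w).
    apply: filterS loc_cst => y' [Vy' y'E] Vy'' /=.
    rewrite (_ : SigSub _ = SigSub (gS w) :> S) //.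
    by apply: val_inj; rewrite /= y'E.
  + move=> [z s]; congr pair; apply: val_inj => /=.
      have [_ psec _ _ _] := secP _ (VS s).
      by rewrite psec //; exact: (set_valP z).
    have [secs _ _ secsec _] := secP _ (VS s).
    rewrite secsec //; last exact: (set_valP z).
    by rewrite -[RHS]secs pS.
  + move=> w; apply: val_inj => /=.
    have [secw _ _ secsec _] := secP _ (set_valP w).
    by rewrite secsec //; exact: (set_valP w).
- move=> [z s] /=; have [_ psec _ _ _] := secP _ (VS s).
  by rewrite psec //; exact: (set_valP z).
Qed.

End sections_of_a_map.

(** * Lifts *)

Section lifting.
Context (R : realType) (Y X : topologicalType) (p : Y -> X).
Hypothesis p_sections : has_local_sections p.

Lemma lift_sheet (V : set X) (sec : Y -> X -> Y) (v : R -> Y) (a b : R) :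
  local_sections p V sec -> continuous v -> a <= b ->
  (forall t, a <= t <= b -> V (p (v t))) ->
  forall z, V z -> sec (v a) z = sec (v b) z.
Proof.
move=> [_ secP] vc ab Vv.
pose P x y := forall z, V z -> sec (v x) z = sec (v y) z.
apply: (@interval_induction _ P) => // [x y z _ _ _ _ Pxy Pyz w Vw|t tab].
  by rewrite Pxy // Pyz.
have [_ _ _ _ loc] := secP _ (Vv t tab).
exists (fun s => forall z, V z -> sec (v s) z = sec (v t) z).
  by apply: filterS (continuous_near (vc t) loc) => s [].
move=> x y /andP[_ xt] /andP[ty _] N z Vz.
by rewrite !N ?lexx ?(le_trans xt ty).
Qed.

Lemma lift_unique (v w : R -> Y) (a b : R) :
  continuous v -> continuous w -> a <= b ->
  (forall t, a <= t <= b -> p (v t) = p (w t)) -> v a = w a -> v b = w b.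
Proof.
move=> vc wc ab pvw.
apply: (@interval_induction _ (fun x y => v x = w x -> v y = w y)) => //.
  by move=> x y z _ _ _ _ Pxy Pyz /Pxy.
move=> t tab; have [V [sec [Vt [_ secP]]]] := p_sections (p (v t)).
have Vt' : V (p (w t)) by rewrite -pvw.
have [vt _ _ _ locv] := secP _ Vt; have [wt _ _ _ locw] := secP _ Vt'.
eexists; first exact: filterI (continuous_near (vc t) locv)
  (continuous_near (wc t) locw).
move=> x y /andP[ax xt] /andP[ty yb] N vwx.
have vwt : v t = w t.
  have [|[_ vx] [_ wx]] := N x; first by rewrite lexx (le_trans xt ty).
  by rewrite -vt -wt -vx // -wx // vwx pvw.
have [|[Vvy vy] [Vwy wy]] := N y; first by rewrite lexx (le_trans xt ty).
have [<- _ _ _ _] := secP _ Vvy; have [<- _ _ _ _] := secP _ Vwy.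
rewrite vy // wy // vwt pvw //; apply/andP; split=> //.
by rewrite (le_trans ax) // (le_trans xt).
Qed.

Lemma lift_exists (u : R -> X) (a b : R) (y : Y) :
  continuous u -> a <= b -> p y = u a ->
  exists v : R -> Y, [/\ continuous v, v a = y &
    forall t, a <= t <= b -> p (v t) = u t].
Proof.
move=> uc ab; move: y.
pose P x z := forall y, p y = u x -> exists v : R -> Y,
  [/\ continuous v, v x = y & forall t, x <= t <= z -> p (v t) = u t].
apply: (@interval_induction _ P) => // [x y z ax xy yz zb Pxy Pyz w pw|t tab].
  have [v [vc vx pv]] := Pxy w pw.
  have [|v' [vc' vy pv']] := Pyz (v y); first by rewrite pv // lexx xy.
  exists (fun t => if t - y + 2^-1 <= 2^-1 then v t else v' t); split.
  + apply: if_continuous => //.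
      move=> t; apply: cvgD; last exact: cvg_cst.
      by apply: cvgB; [exact: cvg_id|exact: cvg_cst].
    by move=> t ty; rewrite (_ : t = y) //; lra.
  + by rewrite ifT //; lra.
  + move=> t /andP[xt tz]; case: ifPn => ty; first by rewrite pv // xt; lra.
    by rewrite pv' // tz andbT; lra.
have [V [sec [Vt [oV secP]]]] := p_sections (u t).
exists (u @^-1` V); first by apply: uc; exact: open_nbhs_nbhs.
move=> x z /andP[ax xt] /andP[tz zb] Vu y py.
have xz : x <= z := le_trans xt tz.
have Vy : V (p y) by rewrite py; apply: Vu; rewrite lexx.
have [secy psec secc _ _] := secP _ Vy.
pose c s := Num.max x (Num.min s z).
have cP s : x <= c s <= z.
  by rewrite /c le_max lexx /= ge_max xz ge_min lexx orbT.
exists (fun s => sec y (u (c s))); split.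
- move=> s; apply: (@continuous_comp _ _ _ (u \o c) (sec y)).
    apply: continuous_comp; last exact: uc.
    apply: (@continuous_maxr R R (fun=> x)) => s'; first exact: cvg_cst.
    apply: (@continuous_minr R R id (fun=> z)) => s''; first exact: cvg_id.
    exact: cvg_cst.
  by apply: secc; apply: Vu.
- have -> : c x = x by rewrite /c min_l // max_l.
  by rewrite -py.
- move=> s /andP[xs sz]; rewrite psec; last exact: Vu.
  by rewrite /c min_l // max_r.
Qed.

Lemma lift_end_continuous (T : topologicalType) (f : T * R -> X)
    (v : T -> R -> Y) (s0 : T) (a b : R) :
  continuous f -> a <= b -> (forall s, continuous (v s)) ->
  (forall s t, a <= t <= b -> p (v s t) = f (s, t)) ->
  {for s0, continuous (v^~ a)} -> {for s0, continuous (v^~ b)}.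
Proof.
move=> fc ab vc pv.
pose P x y := {for s0, continuous (v^~ x)} -> {for s0, continuous (v^~ y)}.
apply: (@interval_induction _ P) => // [x y z _ _ _ _ Pxy Pyz /Pxy//|t tab].
have [V [sec [Vt LS]]] := p_sections (f (s0, t)).
have [oV secP] := LS.
have [[A B] /= [As Bt] ABV] : nbhs (s0, t) (f @^-1` V).
  by apply: fc; exact: open_nbhs_nbhs.
exists B => // x y /andP[ax xt] /andP[ty yb] xyB vx.
have xy := le_trans xt ty.
have xB : B x by apply: xyB; rewrite lexx.
have yB : B y by apply: xyB; rewrite lexx xy.
have xab : a <= x <= b by rewrite ax (le_trans xy).
have yab : a <= y <= b by rewrite yb (le_trans ax).
have Vf s t' : A s -> x <= t' <= y -> V (f (s, t')).
  by move=> As' t'xy; apply: (ABV (s, t')); split => //=; exact: xyB.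
have sheet s : A s -> v s y = sec (v s x) (f (s, y)).
  move=> As'; have Vy : V (f (s, y)) by apply: Vf; rewrite ?lexx ?xy.
  rewrite (lift_sheet LS (vc s) xy) //; first last.
    move=> t' t'xy; rewrite pv; first exact: Vf.
    by case/andP: t'xy => *; rewrite (le_trans ax) // (le_trans _ yb).
  by have [] := secP (v s y); rewrite pv.
have As0 : A s0 := nbhs_singleton As.
have Vx : V (p (v s0 x)) by rewrite pv //; apply: Vf; rewrite ?lexx.
have [_ _ secc _ loc] := secP _ Vx.
have E : \forall s \near s0, v s y = sec (v s0 x) (f (s, y)).
  apply: filterS (filterI As (continuous_near vx loc)) => s [As' [_ secE]].
  by rewrite sheet // secE //; apply: Vf; rewrite ?lexx ?xy.
rewrite /prop_for /= => C; rewrite (sheet _ As0) => NC.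
have fy : {for s0, continuous (fun s => f (s, y))}.
  apply: (@continuous_comp _ _ _ (fun s => (s, y)) f); last exact: fc.
  by apply: (@pair_continuous T T R id (fun=> y)) => s;
    [exact: cvg_id|exact: cst_continuous].
have Vy : V (f (s0, y)) by apply: Vf; rewrite ?lexx ?xy.
have := continuous_near fy (continuous_near (secc _ Vy) NC).
by move=> N; apply: filterS (filterI N E) => s [/= + ->].
Qed.

End lifting.

Section unit_interval_lifts.
Context (R : realType) (Y X : topologicalType) (p : Y -> X).
Hypothesis p_sections : has_local_sections p.
Local Notation I := (unit_interval R).

Lemma continuous_unit_real (T : topologicalType) (v : I -> T) :
  continuous v -> continuous (v \o @to_unit R).
Proof.
by move=> vc t; apply: continuous_comp; [exact: continuous_to_unit|exact: vc].
Qed.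

Lemma unit_lift_unique (v w : I -> Y) :
  continuous v -> continuous w -> (forall t, p (v t) = p (w t)) ->
  v zero = w zero -> v = w.
Proof.
move=> vc wc pvw vw0; apply/funext => t; rewrite -(unit_valK t).
have /andP[t0 _] := unit_val_itv t.
have := lift_unique p_sections (continuous_unit_real vc)
  (continuous_unit_real wc) t0.
by rewrite /= to_unit_le0 // => -> // s _; exact: pvw.
Qed.

Lemma unit_lift_exists (u : I -> X) (y : Y) :
  continuous u -> p y = u zero ->
  exists v : I -> Y,
    [/\ continuous v, v zero = y & forall t, p (v t) = u t].
Proof.
move=> uc py; have [|v [vc v0 pv]] := lift_exists p_sections
  (continuous_unit_real uc) (@ler01 R) (y := y).
  by rewrite /= to_unit_le0.
exists (v \o @unit_val R); split=> [t||t] /=.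
- by apply: continuous_comp; [exact: continuous_unit_val|exact: vc].
- by rewrite unit_val0.
- by rewrite pv ?unit_val_itv //= unit_valK.
Qed.

Lemma homotopic_lift_end (x0 x1 : X) (u u' : {path I from x0 to x1})
    (v v' : I -> Y) :
  path_homotopic u u' -> continuous v -> continuous v' ->
  (forall t, p (v t) = u t) -> (forall t, p (v' t) = u' t) ->
  v zero = v' zero -> v one = v' one.
Proof.
move=> [H [Hc Hu Hu' H0 H1]] vc vc' pv pv' v0.
pose f (q : R * R) := H (to_unit q.2, to_unit q.1).
have fc : continuous f.
  by apply: (homotopy_param Hc) => q; [exact: cvg_snd|exact: cvg_fst].
have /choice[w wP] s : exists w : R -> Y, [/\ continuous w, w 0 = v zero &
    forall t, 0 <= t <= 1 -> p (w t) = f (s, t)].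
  apply: (lift_exists p_sections) => //.
    move=> t.
    apply: (@continuous_comp _ _ _ (fun t => (s, t)) f); last exact: fc.
    by apply: (@pair_continuous R R R (fun=> s) id) => {}t;
      [exact: cst_continuous|exact: cvg_id].
  by rewrite pv /f /= to_unit_le0 // H0 path_zero.
have w1c : continuous (w^~ 1).
  move=> s; apply: (lift_end_continuous p_sections fc (@ler01 R)).
  - by move=> t; have [] := wP t.
  - by move=> t r r01; have [_ _ ->] := wP t.
  - have -> : w^~ 0 = fun=> v zero by apply/funext => t; have [] := wP t.
    exact: cst_continuous.
have w01 : w 0 1 = w 1 1.
  apply: (lift_unique p_sections (v := fun=> w 0 1) (w := w^~ 1)
    _ w1c (@ler01 R)) => // [|t _]; first by move=> t; exact: cst_continuous.
  have [_ _ pw0] := wP 0; have [_ _ pwt] := wP t.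
  by rewrite pw0 ?pwt ?ler01 ?lexx //= /f /= to_unit_ge1 // !H1.
have -> : v one = w 0 1.
  have [w0c w00 pw0] := wP 0.
  rewrite -[v one]/((v \o @to_unit R) 1) /=.
  suff : (v \o @to_unit R) 1 = w 0 1 by rewrite /= (@to_unit_ge1 _ 1).
  apply: (lift_unique p_sections (continuous_unit_real vc) w0c
    (@ler01 R)) => [t t01|/=]; last by rewrite to_unit_le0.
  by rewrite pw0 //= /f /= pv (@to_unit_le0 _ 0) // Hu.
have -> : v' one = w 1 1; last by [].
have [w1c' w10 pw1] := wP 1.
suff : (v' \o @to_unit R) 1 = w 1 1 by rewrite /= (@to_unit_ge1 _ 1).
apply: (lift_unique p_sections (continuous_unit_real vc') w1c'
  (@ler01 R)) => [t t01|/=]; last by rewrite to_unit_le0 // w10.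
by rewrite pw1 //= /f /= pv' (@to_unit_ge1 _ 1) // Hu'.
Qed.

End unit_interval_lifts.

(** * Paths *)

Section subpaths.
Context (R : realType) (X : topologicalType).
Local Notation I := (unit_interval R).

Section one_subpath.
Context (x y : X) (u : {path I from x to y}) (a b : R) (x' y' : X).
Hypotheses (ua : u (to_unit a) = x') (ub : u (to_unit b) = y').

Definition subpath_fun (t : I) : X := u (to_unit ((b - a) * unit_val t + a)).

Lemma subpath_fun_continuous : continuous subpath_fun.
Proof.
apply: continuous_path_param; apply: continuous_affine.
exact: continuous_unit_val.
Qed.

Lemma subpath_fun_zero : subpath_fun zero = x'.
Proof. by rewrite /subpath_fun unit_val0 mulr0 add0r. Qed.

Lemma subpath_fun_one : subpath_fun one = y'.
Proof. by rewrite /subpath_fun unit_val1 mulr1 subrK. Qed.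

Definition subpath : {path I from x' to y'} :=
  mk_path subpath_fun_continuous subpath_fun_zero subpath_fun_one.

Lemma subpathE (t : I) :
  subpath t = u (to_unit ((b - a) * unit_val t + a)).
Proof. by []. Qed.

End one_subpath.
Arguments subpath {x y} u {a b x' y'} ua ub.

Lemma subpath_concat (x y : X) (u : {path I from x to y}) (a b c : R)
    (x' y' z' : X) (ua : u (to_unit a) = x') (ub : u (to_unit b) = y')
    (uc : u (to_unit c) = z') :
  path_homotopic (concat (subpath u ua ub) (subpath u ub uc)) (subpath u ua uc).
Proof.
apply: (@path_homotopic_param _ _ _ _ _ _ _ _ u
  (fun t => (b - a) * Num.min 1 (2 * unit_val t + 0) +
            ((c - b) * Num.max 0 (2 * unit_val t + - 1) + a))
  (fun t => (c - a) * unit_val t + a)).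
- have c1 : continuous (fun t : I => (b - a) * Num.min 1 (2 * unit_val t + 0)).
    apply: continuous_scale; apply: continuous_minr.
      exact: continuous_const.
    by apply: continuous_affine; exact: continuous_unit_val.
  have c2 : continuous
      (fun t : I => (c - b) * Num.max 0 (2 * unit_val t + - 1) + a).
    apply: continuous_affine; apply: continuous_maxr.
      exact: continuous_const.
    by apply: continuous_affine; exact: continuous_unit_val.
  by move=> t; exact: cvgD (c1 t) (c2 t).
- by apply: continuous_affine; exact: continuous_unit_val.
- by rewrite unit_val0 min_r ?max_l //; lra.
- by rewrite unit_val1 min_l ?max_r //; lra.
- move=> t; have /andP[t0 t1] := unit_val_itv t.
  have [t2|t2] := lerP (unit_val t) 2^-1.
    rewrite (concat_le _ _ t2) subpathE to_unitE; last first.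
      by apply/andP; split; lra.
    by rewrite min_r ?max_l; [congr (u (to_unit _)); lra|lra|lra].
  rewrite (concat_gt _ _ t2) subpathE to_unitE; last by apply/andP; split; lra.
  by rewrite min_l ?max_r; [congr (u (to_unit _)); lra|lra|lra].
- by move=> t; rewrite subpathE; congr (u (to_unit _)); lra.
Qed.

Lemma subpath_full (x y : X) (u : {path I from x to y})
    (u0 : u (to_unit 0) = x) (u1 : u (to_unit 1) = y) : subpath u u0 u1 = u.
Proof.
by apply/path_eqP => t; rewrite subpathE subr0 mul1r addr0 unit_valK.
Qed.

Lemma subpath_cst (x y : X) (u : {path I from x to y}) (a : R) (x' : X)
    (ua ua' : u (to_unit a) = x') :
  subpath u ua ua' = (cst x' : {path I from x' to x'}).
Proof. by apply/path_eqP => t; rewrite subpathE subrr mul0r add0r. Qed.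

Lemma path_to_unit0 (x y : X) (u : {path I from x to y}) : u (to_unit 0) = x.
Proof. by rewrite to_unit_le0 // path_zero. Qed.

Lemma path_to_unit1 (x y : X) (u : {path I from x to y}) : u (to_unit 1) = y.
Proof. by rewrite to_unit_ge1 // path_one. Qed.

Definition path_rev (x y : X) (u : {path I from x to y}) :
  {path I from y to x} := subpath u (path_to_unit1 u) (path_to_unit0 u).

Lemma concat_rev_l (x y : X) (u : {path I from x to y}) :
  path_homotopic (concat (path_rev u) u) (cst y).
Proof.
have := subpath_concat (path_to_unit1 u) (path_to_unit0 u) (path_to_unit1 u).
by rewrite subpath_full subpath_cst.
Qed.

Lemma range_subpath (x y : X) (u : {path I from x to y}) (a b : R)
    (x' y' : X) (ua : u (to_unit a) = x') (ub : u (to_unit b) = y') :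
  range (subpath u ua ub) `<=` range u.
Proof. by move=> _ [t _ <-]; exact: imageT. Qed.

Lemma path_end_range (x y : X) (u : {path I from x to y}) : range u y.
Proof. by exists one => //; exact: path_one. Qed.

Lemma range_concat (x y z : X) (u : {path I from x to y})
    (v : {path I from y to z}) (V : set X) :
  range u `<=` V -> range v `<=` V -> range (concat u v) `<=` V.
Proof.
move=> uV vV _ [t _ <-]; rewrite concatE /concat_fun.
by case: ifP => _; [apply: uV|apply: vV]; exact: imageT.
Qed.

Lemma loops_contractible_homotopic (x z : X) (V : set X)
    (u v : {path I from x to z}) :
  loops_contractible R x V -> range u `<=` V -> range v `<=` V ->
  path_homotopic u v.
Proof.
move=> Vc uV vV.
apply: path_homotopic_trans (path_homotopic_sym (concat_cst_r u)) _.
apply: path_homotopic_trans.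
  apply: (concat_homotopic (path_homotopic_refl u)).
  exact: path_homotopic_sym (concat_rev_l v).
apply: path_homotopic_trans (concatA _ _ _) _.
apply: path_homotopic_trans (concat_cst_l v).
apply: concat_homotopic (path_homotopic_refl v).
apply: Vc; apply: range_concat => //.
exact: subset_trans (@range_subpath _ _ _ _ _ _ _ _ _) vV.
Qed.

Lemma admissible_basis :
  locally_path_connected R X -> semilocally_simply_connected R X ->
  forall (x : X) (N : set X), nbhs x N ->
    exists2 V, admissible R x V & V `<=` N.
Proof.
move=> lpc slsc x N Nx; have [V [Vx VN Vc]] := slsc x N Nx.
pose W := [set z | exists u : {path I from x to z}, range u `<=` V°].
have WV : W `<=` V.
  by move=> z [u uV]; exact: (interior_subset (uV _ (path_end_range u))).
exists W; last exact: subset_trans VN.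
have path_in_W z (u : {path I from x to z}) :
    range u `<=` V° -> range u `<=` W.
  move=> uV _ [t _ <-].
  have ut : u (to_unit (unit_val t)) = u t by rewrite unit_valK.
  exists (subpath u (path_to_unit0 u) ut).
  exact: subset_trans (@range_subpath _ _ _ _ _ _ _ _ _) uV.
split.
- rewrite openE => z [u uV].
  have Vz : nbhs z V°.
    apply: open_nbhs_nbhs; split; first exact: open_interior.
    exact: (uV _ (path_end_range u)).
  have [V' [V'z V'V V'c]] := lpc z _ Vz.
  have V'z0 := nbhs_singleton V'z.
  apply: filterS V'z => z' V'z'.
  have [v vV'] := V'c z z' V'z0 V'z'.
  exists (concat u v); apply: range_concat => //; exact: subset_trans V'V.
- exists (cst x) => _ [t _ <-]; exact: Vx.
- move=> z z' [u uV] [v vV]; exists (concat (path_rev u) v).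
  apply: range_concat; last exact: path_in_W.
  exact: subset_trans (@range_subpath _ _ _ _ _ _ _ _ _) (path_in_W _ _ uV).
- by move=> u uW; apply: Vc; exact: subset_trans WV.
Qed.

End subpaths.
Arguments subpath {R X x y} u {a b x' y'} ua ub.

(** * Monodromy *)

Lemma bigcup_subfamilyP (T : Type) (B : set (set T)) (A : set T) :
  [set \bigcup_(b in D) b | D in subset^~ B] A <->
  forall x, A x -> exists b, [/\ B b, b x & b `<=` A].
Proof.
split=> [[D DB <-] x [b Db bx]|AB].
  by exists b; split; [exact: DB|by []|exact: bigcup_sup].
exists [set b | B b /\ b `<=` A]; first by move=> b [].
apply/seteqP; split=> [x [b [_ bA] /bA//]|x /AB[b [Bb bx bA]]].
by exists b.
Qed.

Section transport_laws.
Context (R : realType) (X : topologicalType) (U : Type).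
Local Notation I := (unit_interval R).
Local Notation Pi := (fundamental_groupoid R X).
Implicit Types F G : functor Pi (sets U).

Lemma transport_homotopic F (x y : X) (u v : {path I from x to y})
    (a : fibre F x) :
  path_homotopic u v -> transport u a = transport v a.
Proof. by rewrite /transport => /class_of_eq ->. Qed.

Lemma transport_cst F (x : X) (a : fibre F x) : transport (cst x) a = a.
Proof.
exact: (congr1 (fun f : fibre F x -> fibre F x => f a) (fmap_id F x)).
Qed.

Lemma transport_concat F (x y z : X) (u : {path I from x to y})
    (v : {path I from y to z}) (a : fibre F x) :
  transport (concat u v) a = transport v (transport u a).
Proof.
rewrite /transport -class_concatE.
exact: (congr1 (fun f : fibre F x -> fibre F z => f a)
  (fmap_comp F (class_of u : @hom Pi x y) (class_of v : @hom Pi y z))).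
Qed.

Lemma set_functor_eq F G :
  (forall x, fibre F x = fibre G x) ->
  (forall (x y : X) (u : {path I from x to y}) (a : fibre F x) (b : fibre G x),
     \val a = \val b -> \val (transport u a) = \val (transport u b)) ->
  F = G.
Proof.
rewrite /fibre /transport.
case: F G => [F0 F1 Fid Fcomp] [G0 G1 Gid Gcomp] /= FG0.
have e : F0 = G0 by apply/funext.
subst G0 => FG.
have e : F1 = G1.
  apply: functional_extensionality_dep => x.
  apply: functional_extensionality_dep => y.
  apply/funext => c; apply/funext => a; apply: val_inj.
  by rewrite -(class_reprK c); exact: FG.
subst G1.
by rewrite (Prop_irrelevance Fid Gid) (Prop_irrelevance Fcomp Gcomp).
Qed.

Lemma natural_transport F G (s : natural_transformation F G) (x y : X)
    (u : {path I from x to y}) (a : fibre F x) :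
  s y (transport u a) = transport (F := G) u (s x a).
Proof. exact: (congr1 (fun f : fibre F x -> fibre G y => f a)
  (naturality s (class_of u : @hom Pi x y))). Qed.

End transport_laws.

Section monodromy.
Context (R : realType) (X : topologicalType) (U : Type).
Local Notation I := (unit_interval R).
Local Notation Pi := (fundamental_groupoid R X).
Implicit Types F G : functor Pi (sets U).
Implicit Types Y : space_over X U.

Lemma monodromy_fibreP Y F x (y : total_space Y) :
  monodromy_of Y F -> fibre F x (\val y) <-> projection y = x.
Proof.
move=> [fibE _]; rewrite fibE; split=> [[y' py' /val_inj <-//]|py].
by exists y.
Qed.

Lemma monodromy_fibre_point Y F x (a : fibre F x) :
  monodromy_of Y F ->
  exists2 y : total_space Y, \val y = \val a & projection y = x.
Proof.
move=> [fibE _]; have := set_valP a.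
by rewrite [X in X _ -> _]fibE => -[y py ya]; exists y.
Qed.

Lemma monodromy_point_fibre Y F (y : total_space Y) :
  monodromy_of Y F -> exists a : fibre F (projection y), \val a = \val y.
Proof.
move=> mon; have yF : \val y \in fibre F (projection y).
  by apply/mem_set/(monodromy_fibreP _ _ mon).
by exists (SigSub yF).
Qed.

Lemma monodromy_transport Y F (x0 x1 : X) (u : {path I from x0 to x1})
    (a : fibre F x0) (y : total_space Y) (v : I -> total_space Y) :
  monodromy_of Y F -> \val y = \val a -> is_lift u y v ->
  \val (transport u a) = \val (v one).
Proof.
move=> [_ mon] ya uv.
by have [w [_ wv] ->] := mon _ _ u a y ya; rewrite (wv v).
Qed.

Lemma monodromy_of_unique Y F G :
  monodromy_of Y F -> monodromy_of Y G -> F = G.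
Proof.
move=> monF monG; apply: set_functor_eq => [x|x y u a b ab].
  by case: monF monG => [-> _] [-> _].
have [w wa _] := monodromy_fibre_point a monF.
have [_ /(_ _ _ u a w wa)[v [uv _] ->]] := monF.
by rewrite (monodromy_transport monG _ uv) // wa.
Qed.

Section existence.
Context (Y : space_over X U).
Hypothesis Y_sections : has_local_sections (@projection X U Y).
Local Notation p := (@projection X U Y).

Let fib (x : X) : set U := [set \val y | y in p @^-1` [set x]].

Let ends (x0 x1 : X) (c : path_class R x0 x1) (a : fib x0) (b : fib x1) :
    Prop :=
  exists (u : {path I from x0 to x1}) (y : total_space Y) v,
    [/\ class_of u = c, \val y = \val a, is_lift u y v & \val b = \val (v one)].

Let ends_total x0 x1 (c : path_class R x0 x1) (a : fib x0) :
  exists b : fib x1, ends c a b.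
Proof.
have [y py ya] := set_valP a.
have [|v [vc v0 pv]] := unit_lift_exists Y_sections
  (u := class_repr c) (y := y) (@cts_fun _ _ _).
  by rewrite path_zero.
have vF : \val (v one) \in fib x1.
  by apply/mem_set; exists (v one); rewrite //= pv path_one.
exists (SigSub vF), (class_repr c), y, v; split=> //; exact: class_reprK.
Qed.

Let ends_fun x0 x1 (c : path_class R x0 x1) (a : fib x0) (b b' : fib x1) :
  ends c a b -> ends c a b' -> b = b'.
Proof.
move=> [u [y [v [uc ya [vc v0 pv] bv]]]].
move=> [u' [y' [v' [uc' ya' [vc' v0' pv'] bv']]]].
apply: val_inj; rewrite bv bv'; congr \val.
apply: (homotopic_lift_end Y_sections _ vc vc' pv pv').
  by apply/class_of_eq; rewrite uc uc'.
by rewrite v0 v0'; apply: val_inj; rewrite ya ya'.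
Qed.

Let ends_id x (a : fib x) : ends (class_of (cst x)) a a.
Proof.
have [y py ya] := set_valP a.
exists (cst x), y, (fun=> y); split=> //; split=> //; exact: cst_continuous.
Qed.

Let ends_comp x y z (c : path_class R x y) (d : path_class R y z)
    (a : fib x) (b : fib y) (e : fib z) :
  ends c a b -> ends d b e -> ends (class_concat c d) a e.
Proof.
move=> [u [w [v [<- wa [vc v0 pv] bv]]]].
move=> [u' [w' [v' [<- wb [vc' v0' pv'] ev]]]].
have v1 : v' zero = v one by rewrite v0'; apply: val_inj; rewrite wb bv.
pose vp : {path I from w to v one} := mk_path vc v0 erefl.
pose vp' : {path I from v one to v' one} := mk_path vc' v1 erefl.
exists (concat u u'), w, (concat vp vp'); split=> //.
- by rewrite class_concatE.
- split; [exact: cts_fun|exact: path_zero|move=> t].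
  by rewrite !concatE /concat_fun; case: ifP => _; [exact: pv|exact: pv'].
- by rewrite path_one.
Qed.

Let F1 (x y : Pi) (c : hom x y) (a : fib x) : fib y :=
  sval (cid (ends_total c a)).

Let F1P (x y : Pi) (c : hom x y) (a : fib x) : ends c a (F1 c a) :=
  svalP (cid (ends_total c a)).

Lemma monodromy_exists : exists F, monodromy_of Y F.
Proof.
have F1id (x : Pi) : F1 (idm x) = idfun.
  apply/funext => a; exact: ends_fun (F1P _ _) (ends_id a).
have F1comp (x y z : Pi) (c : hom x y) (d : hom y z) :
    F1 (comp c d) = F1 d \o F1 c.
  apply/funext => a; apply: ends_fun (F1P _ _) _.
  exact: ends_comp (F1P _ _) (F1P _ _).
exists (@Functor Pi (sets U) fib F1 F1id F1comp); split=> // x0 x1 u a y ya.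
have [y' py' ya'] := set_valP a.
have [|v [vc v0 pv]] := unit_lift_exists Y_sections
  (u := u) (y := y) (@cts_fun _ _ _).
  by rewrite path_zero -py'; congr (p _); apply: val_inj; rewrite ya.
exists v.
  split=> // w [wc w0 pw]; apply: (unit_lift_unique Y_sections) => //.
    by move=> t; rewrite pv pw.
  by rewrite v0 w0.
have [u' [w [v' [uu' wa [vc' v0' pv'] ->]]]] := F1P (class_of u) a.
congr \val; apply: (homotopic_lift_end Y_sections _ vc' vc pv' pv).
  exact/class_of_eq.
by rewrite v0' v0; apply: val_inj; rewrite wa ya.
Qed.

End existence.

End monodromy.

(** * Sheets *)

Section sheet_topology.
Context (R : realType) (X : topologicalType) (U : Type).
Local Notation I := (unit_interval R).
Local Notation Pi := (fundamental_groupoid R X).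
Implicit Types F G : functor Pi (sets U).
Implicit Types Y : space_over X U.
Hypothesis X_lpc : locally_path_connected R X.
Hypothesis X_slsc : semilocally_simply_connected R X.

Lemma union_of_unique F Y Y' : union_of F Y -> union_of F Y' -> Y = Y'.
Proof.
move=> []; case: Y => A O OT OI Obigcup q /= cA qF OF.
move=> []; case: Y' => A' O' OT' OI' Obigcup' q' /= cA' qF' OF'.
have e : A = A' by rewrite cA cA'.
clear cA'; subst A'.
have e : O = O' by exact: etrans OF (esym OF').
clear OF OF'; subst O'.
have e : q = q'.
  apply/funext => y; have := set_valP y; rewrite [X in X _ -> _]cA.
  move=> [x _ Fxy]; have := qF x y Fxy; have := qF' x y Fxy.
  by rewrite /projection /= => -> ->.
subst q'.
by rewrite (Prop_irrelevance OT OT') (Prop_irrelevance OI OI')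
  (Prop_irrelevance Obigcup Obigcup').
Qed.

Lemma admissible_homotopic (x y z : X) (V : set X)
    (u v : {path I from y to z}) :
  admissible R x V -> range u `<=` V -> range v `<=` V -> path_homotopic u v.
Proof.
move=> [_ Vx Vpc Vc] uV vV.
have Vy : V y by apply: uV; exists zero => //; exact: path_zero.
have [r rV] := Vpc _ _ Vx Vy.
apply: path_homotopic_trans (path_homotopic_sym (concat_cst_l u)) _.
apply: path_homotopic_trans.
  exact: concat_homotopic (path_homotopic_sym (concat_rev_l r))
    (path_homotopic_refl u).
apply: path_homotopic_trans (path_homotopic_sym (concatA _ _ _)) _.
apply: path_homotopic_trans.
  apply: (concat_homotopic (path_homotopic_refl (path_rev r))).
  apply: (loops_contractible_homotopic Vc (v := concat r v));
    exact: range_concat.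
apply: path_homotopic_trans (concatA _ _ _) _.
apply: path_homotopic_trans (concat_cst_l v).
exact: concat_homotopic (concat_rev_l r) (path_homotopic_refl v).
Qed.

Lemma admissible_base (x y : X) (V : set X) :
  admissible R x V -> V y -> admissible R y V.
Proof.
move=> Vadm Vy; have [oV Vx Vpc Vc] := Vadm; split=> // u uV.
by apply: admissible_homotopic Vadm uV _ => _ [t _ <-].
Qed.

Lemma sheet_base F Y (x : X) (V : set X) (a : fibre F x) (y : total_space Y) :
  V x -> \val y = \val a -> sheet V a y.
Proof.
move=> Vx ya; exists x, (cst x); split; first by move=> _ [t _ <-].
by rewrite transport_cst.
Qed.

Lemma sheet_subset F Y (x z : X) (V W : set X) (u : {path I from x to z})
    (a : fibre F x) :
  range u `<=` V -> W `<=` V ->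
  sheet (Y := Y) W (transport u a) `<=` sheet V a.
Proof.
rewrite /sheet /= => uV WV w [z' [v [vW wE]]]; exists z', (concat u v).
rewrite transport_concat; split=> //.
by apply: range_concat uV _; exact: subset_trans WV.
Qed.

Lemma monodromy_union F Y :
  continuous (@projection X U Y) -> has_local_sections (@projection X U Y) ->
  monodromy_of Y F -> union_of F Y.
Proof.
set p := @projection X U Y => pc Ysec mon.
have sheet_lift (w : total_space Y) (V0 : set X) sec z (a : fibre F (p w))
    (r : {path I from p w to z}) :
    local_sections p V0 sec -> range r `<=` V0 -> \val w = \val a ->
    \val (transport r a) = \val (sec w z).
  move=> [oV0 secP] rV0 wa.
  have rV t : V0 (r t) by apply: rV0; exact: imageT.
  have V0w : V0 (p w) by have := rV zero; rewrite path_zero.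
  have [secw psec secc _ _] := secP w V0w.
  have -> : sec w z = sec w (r one) by rewrite path_one.
  apply: (monodromy_transport (v := fun t => sec w (r t)) mon wa); split.
  - move=> t; apply: (@continuous_comp _ _ _ r (sec w)); first exact: cts_fun.
    exact: secc.
  - by rewrite path_zero.
  - by move=> t; exact: psec.
have sheet_open x V (a : fibre F x) :
    admissible R x V -> open (sheet (Y := Y) V a).
  move=> [oV Vx Vpc Vc]; rewrite openE => w [z [u [uV wa]]].
  have pw : p w = z.
    by apply/(monodromy_fibreP _ _ mon); rewrite wa; exact: set_valP.
  subst z.
  have [V0 [sec [V0w LS]]] := Ysec (p w); have [oV0 secP] := LS.
  have Vw : V (p w) := uV _ (path_end_range u).
  have [|W [Ww WV Wpc]] := X_lpc (x := p w) (N := V `&` V0).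
    by apply: filterI; exact: open_nbhs_nbhs.
  have [_ _ _ _ loc] := secP _ V0w.
  apply: filterS (filterI loc (continuous_near (pc w) Ww)).
  move=> w' [[V0w' secE] Ww'].
  have [r rW] := Wpc _ _ (nbhs_singleton Ww) Ww'.
  have rV := subset_trans rW WV.
  exists (p w'), (concat u r); split.
    by apply: range_concat uV _ => t /rV[].
  rewrite transport_concat (sheet_lift w V0 sec) //; last by move=> t /rV[].
  by rewrite -secE //; have [-> ] := secP _ V0w'.
split.
- apply/seteqP; split=> [y Yy|y [x _ Fxy]].
    pose w : total_space Y := SigSub (mem_set Yy).
    have [a aw] := monodromy_point_fibre w mon.
    by exists (p w) => //; rewrite -[y]/(\val w) -aw; exact: set_valP.
  have [w wy _] := monodromy_fibre_point (SigSub (mem_set Fxy)) mon.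
  have <- : \val w = y by exact: wy.
  exact: set_valP.
- by move=> x y /(monodromy_fibreP _ _ mon).
- apply/seteqP; split=> O; last first.
    move=> [D DS <-]; apply: opens_bigcup => B /DS[x [V [a [Vadm ->]]]].
    exact: sheet_open.
  move=> oO; apply/bigcup_subfamilyP => w Ow.
  have [a aw] := monodromy_point_fibre w mon.
  have [V0 [sec [V0w LS]]] := Ysec (p w); have [oV0 secP] := LS.
  have [secw psec secc _ _] := secP _ V0w.
  have NO : \forall z \near p w, V0 z /\ O (sec w z).
    apply: filterI; first exact: open_nbhs_nbhs.
    apply: continuous_near (secc _ V0w) _; rewrite secw.
    exact: open_nbhs_nbhs.
  have [V Vadm VO] := admissible_basis X_lpc X_slsc NO.
  exists (sheet V a); split.
  + by exists (p w), V, a.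
  + by apply: sheet_base; rewrite ?aw //; case: Vadm.
  + move=> w' [z [r [rV w'a]]].
    have -> : w' = sec w z.
      apply: val_inj; rewrite w'a (sheet_lift w V0 sec) // => t /rV /VO[] //.
    by have [] := VO _ (rV _ (path_end_range r)).
Qed.

End sheet_topology.

Section union_spaces.
Context (R : realType) (X : topologicalType) (U : Type).
Local Notation I := (unit_interval R).
Local Notation Pi := (fundamental_groupoid R X).
Implicit Types F G : functor Pi (sets U).
Implicit Types Y : space_over X U.
Hypothesis X_lpc : locally_path_connected R X.
Hypothesis X_slsc : semilocally_simply_connected R X.

Lemma disjoint_values_eq F (x y : X) (a : U) :
  disjoint_values F -> fibre F x a -> fibre F y a -> x = y.
Proof. by move=> dF Fx Fy; apply: dF => //; exists a. Qed.

Lemma sheets_refine F Y (y : total_space Y) (B1 B2 : set (total_space Y)) :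
  disjoint_values F -> sheets F B1 -> sheets F B2 -> B1 y -> B2 y ->
  exists B, [/\ sheets F B, B y & B `<=` B1 `&` B2].
Proof.
move=> dF [x1 [V1 [a1 [V1adm ->]]]] [x2 [V2 [a2 [V2adm ->]]]].
move=> [z [u1 [u1V ya1]]] [z' [u2 [u2V ya2]]].
have ez : z = z'.
  by apply: (disjoint_values_eq (a := \val y) dF); [rewrite ya1|rewrite ya2];
    exact: set_valP.
subst z'.
have V12 : nbhs z (V1 `&` V2).
  have [[oV1 _ _ _] [oV2 _ _ _]] := (V1adm, V2adm).
  by apply: filterI; apply: open_nbhs_nbhs; split=> //;
    [exact: (u1V _ (path_end_range u1))|exact: (u2V _ (path_end_range u2))].
have [W Wadm WV] := admissible_basis X_lpc X_slsc V12.
exists (sheet W (transport u1 a1)); split.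
- by exists z, W, (transport u1 a1).
- by apply: sheet_base => //; case: Wadm.
- rewrite subsetI; split; first by apply: sheet_subset => // t /WV[].
  have -> : transport u1 a1 = transport u2 a2 by apply: val_inj; rewrite -ya1.
  by apply: sheet_subset => // t /WV[].
Qed.

Lemma union_exists F : disjoint_values F -> exists Y, union_of F Y.
Proof.
move=> dF; pose A := \bigcup_x fibre F x.
have /choice[q qP] (y : A) : exists x, fibre F x (\val y).
  by have [x _ Fx] := set_valP y; exists x.
(* The sheets depend on the carrier of the space only, so the topology that
   they generate can be defined from those of the discrete space [Y0]. *)
pose Y0 := @SpaceOver X U A setT
  Logic.I (fun _ _ _ _ => Logic.I) (fun _ _ => Logic.I) q.
pose O : set (set A) :=
  [set \bigcup_(B in D) B | D in subset^~ (@sheets R X U F Y0)].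
have OT : O setT.
  apply/bigcup_subfamilyP => y _.
  have [V Vadm _] := admissible_basis X_lpc X_slsc (@filterT _ (nbhs (q y)) _).
  have yF : \val y \in fibre F (q y) by exact/mem_set/qP.
  exists (@sheet R X U F Y0 (q y) V (SigSub yF)); split=> //.
    by exists (q y), V, (SigSub yF).
  by apply: sheet_base => //; case: Vadm.
have OI B C : O B -> O C -> O (B `&` C).
  move=> /bigcup_subfamilyP OB /bigcup_subfamilyP OC.
  apply/bigcup_subfamilyP => y [By Cy].
  have [B' [B'S B'y B'B]] := OB _ By; have [C' [C'S C'y C'C]] := OC _ Cy.
  have [D [DS Dy DBC]] := sheets_refine (Y := Y0) dF B'S C'S B'y C'y.
  by exists D; split=> // w /DBC[/B'B ? /C'C].
have Obigcup (D : set (set A)) : D `<=` O -> O (\bigcup_(B in D) B).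
  move=> DO; apply/bigcup_subfamilyP => y [B DB By].
  have /bigcup_subfamilyP/(_ _ By)[C [CS Cy CB]] := DO _ DB.
  by exists C; split=> // w /CB Bw; exists B.
exists (@SpaceOver X U A O OT OI Obigcup q); split=> // x y Fx.
exact: (disjoint_values_eq (a := \val y) dF (qP y) Fx).
Qed.

Section union_space.
Context (F : functor Pi (sets U)) (Y : space_over X U).
Hypothesis FY : union_of F Y.
Local Notation p := (@projection X U Y).

Lemma union_fibreP x (y : total_space Y) : fibre F x (\val y) <-> p y = x.
Proof.
have [cY pF _] := FY; split=> [/pF//|<-].
have := set_valP y; rewrite [X in X _ -> _]cY => -[x' _ Fx'].
by rewrite (pF _ _ Fx').
Qed.

Lemma union_point_fibre (y : total_space Y) :
  exists a : fibre F (p y), \val a = \val y.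
Proof.
have yF : \val y \in fibre F (p y) by apply/mem_set/union_fibreP.
by exists (SigSub yF).
Qed.

Lemma union_fibre_point x (a : fibre F x) :
  exists2 y : total_space Y, \val y = \val a & p y = x.
Proof.
have ay : \val a \in carrier Y.
  have [cY _ _] := FY; apply/mem_set; rewrite cY.
  by exists x => //; exact: set_valP.
exists (SigSub ay : total_space Y) => //.
by apply/union_fibreP; exact: (set_valP a).
Qed.

Lemma sheet_nbhs (y : total_space Y) (V : set X) (a : fibre F (p y)) :
  admissible R (p y) V -> \val y = \val a ->
  \forall w \near y, sheet (Y := Y) V a w.
Proof.
move=> Vadm ya; apply: open_nbhs_nbhs; split; last first.
  by apply: sheet_base => //; case: Vadm.
rewrite openE_total_space; have [_ _ ->] := FY.
exists [set sheet V a]; last by rewrite bigcup_set1.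
by move=> _ ->; exists (p y), V, a.
Qed.

Lemma sheet_basis (y : total_space Y) (a : fibre F (p y))
    (N : set X) (O : set (total_space Y)) :
  \val y = \val a -> nbhs (p y) N -> nbhs y O ->
  exists V, [/\ admissible R (p y) V, V `<=` N & sheet V a `<=` O].
Proof.
move=> ya Ny; rewrite nbhsE => -[O' [oO' O'y] O'O].
move: oO'; rewrite openE_total_space; have [_ _ ->] := FY.
move=> /bigcup_subfamilyP/(_ _ O'y)[_ [[x [V [b [Vadm ->]]]]]].
move=> [z [u [uV yu]]] VO'.
have pz : p y = z by apply/union_fibreP; rewrite yu; exact: set_valP.
subst z.
have [oV _ _ _] := Vadm.
have NV : nbhs (p y) (N `&` V).
  apply: filterI => //; apply: open_nbhs_nbhs; split=> //.
  exact: (uV _ (path_end_range u)).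
have [W Wadm WNV] := admissible_basis X_lpc X_slsc NV.
exists W; split=> // [t /WNV[]//|].
apply: subset_trans O'O; apply: subset_trans VO'.
have -> : a = transport u b by apply: val_inj; rewrite -ya.
by apply: sheet_subset => // t /WNV[].
Qed.

Lemma union_projection_continuous : continuous p.
Proof.
move=> y N Ny; have [a ay] := union_point_fibre y.
have [V [Vadm VN _]] := sheet_basis (esym ay) Ny (@filterT _ (nbhs y) _).
apply: filterS (sheet_nbhs Vadm (esym ay)) => w [z [r [rV wr]]].
have pw : p w = z by apply/union_fibreP; rewrite wr; exact: set_valP.
by rewrite /preimage/= pw; exact: VN (rV _ (path_end_range r)).
Qed.

Lemma union_has_local_sections : has_local_sections p.
Proof.
move=> x.
have [V Vadm _] := admissible_basis X_lpc X_slsc (@filterT _ (nbhs x) _).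
have [oV Vx Vpc _] := Vadm.
pose on_sheet (y : total_space Y) (z : X) (w : total_space Y) :=
  exists (r : {path I from p y to z}) (a : fibre F (p y)),
  [/\ range r `<=` V, \val a = \val y & \val w = \val (transport r a)].
have on_sheet_total y z : exists w, V (p y) -> V z -> on_sheet y z w.
  have [Vy|] := pselect (V (p y)); last by exists y.
  have [Vz|] := pselect (V z); last by exists y.
  have [r rV] := Vpc _ _ Vy Vz; have [a ay] := union_point_fibre y.
  have [w wa _] := union_fibre_point (transport r a).
  by exists w => _ _; exists r, a.
have on_sheet_fun y z w w' : on_sheet y z w -> on_sheet y z w' -> w = w'.
  move=> [r [a [rV ay wr]]] [r' [a' [rV' ay' wr']]]; apply: val_inj.
  have aa' : a = a' by apply: val_inj; rewrite ay.
  rewrite wr wr' -aa'; congr \val.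
  exact: transport_homotopic (admissible_homotopic Vadm rV rV').
have on_sheet_proj y z w : on_sheet y z w -> p w = z.
  by move=> [r [a [_ _ wr]]]; apply/union_fibreP; rewrite wr; exact: set_valP.
have /choice[f fP] q : exists w, V (p q.1) -> V q.2 -> on_sheet q.1 q.2 w.
  exact: on_sheet_total.
pose sec y z := f (y, z).
have secP y z : V (p y) -> V z -> on_sheet y z (sec y z) by exact: (fP (y, z)).
have on_sheet_trans y z z' w : V (p y) -> V z -> V z' ->
    on_sheet (sec y z) z' w -> w = sec y z'.
  move=> Vy Vz Vz' [r [a [rV ay wr]]]; apply: on_sheet_fun (secP _ _ Vy Vz').
  have yz := secP _ _ Vy Vz; have pz := on_sheet_proj _ _ _ yz.
  have [r0 [a0 [r0V ay0 yr0]]] := yz.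
  move: r a rV ay wr; rewrite pz => r a rV ay wr.
  exists (concat r0 r), a0; split=> //; first exact: range_concat.
  rewrite transport_concat wr; congr (\val (transport r _)).
  by apply: val_inj; rewrite ay yr0.
exists V, sec; split=> //; split=> // y Vy; split.
- apply: on_sheet_fun (secP _ _ Vy Vy) _.
  have [a ay] := union_point_fibre y.
  exists (cst (p y)), a; split=> //; first by move=> _ [t _ <-].
  by rewrite transport_cst.
- by move=> z Vz; apply: on_sheet_proj; exact: secP.
- move=> z Vz O NO; have pz := on_sheet_proj _ _ _ (secP _ _ Vy Vz).
  have [a ay] := union_point_fibre (sec y z).
  have NV : nbhs (p (sec y z)) V by rewrite pz; exact: open_nbhs_nbhs.
  have [W [Wadm WV WO]] := sheet_basis (esym ay) NV NO.
  have [oW Wz Wpc _] := Wadm.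
  have : nbhs z W by rewrite -pz; exact: open_nbhs_nbhs.
  apply: filterS => z' Wz'; apply: WO.
  have [r rW] := Wpc _ _ Wz Wz'.
  have [w wr _] := union_fibre_point (transport r a).
  have <- : w = sec y z'.
    apply: (on_sheet_trans y z) => //; first exact: WV.
    by exists r, a; split=> //; exact: subset_trans WV.
  by exists z', r.
- move=> z z' Vz Vz'; apply: (on_sheet_trans y z) => //.
  by have pz := on_sheet_proj _ _ _ (secP _ _ Vy Vz); apply: secP; rewrite ?pz.
- have [a ay] := union_point_fibre y.
  apply: filterS (sheet_nbhs (admissible_base Vadm Vy) (esym ay)).
  move=> w [z [r [rV wr]]].
  have yw : on_sheet y z w by exists r, a.
  have Vz : V z := rV _ (path_end_range r).
  have -> : w = sec y z by exact: on_sheet_fun yw (secP _ _ Vy Vz).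
  have pz := on_sheet_proj _ _ _ (secP _ _ Vy Vz).
  split=> [|z' Vz']; first by rewrite pz.
  by apply: (on_sheet_trans y z) => //; apply: secP; rewrite ?pz.
Qed.

Lemma union_monodromy : monodromy_of Y F.
Proof.
split=> [x|x0 x1 u a y ya].
  apply/seteqP; split=> [b Fb|_ [y py <-]]; last exact/union_fibreP.
  have [w wb pw] := union_fibre_point (SigSub (mem_set Fb)).
  by exists w.
have py : p y = x0 by apply/union_fibreP; rewrite ya; exact: set_valP.
(* The end points [b] and [x'] are kept abstract because the end points of
   [subpath] are given by propositional equalities. *)
have /choice[v vP] (t : I) : exists w : total_space Y,
    forall b x' (ub : u (to_unit b) = x'), b = unit_val t ->
    \val w = \val (transport (subpath u (path_to_unit0 u) ub) a).
  have [w wa _] := union_fibre_point (transport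
    (subpath u (path_to_unit0 u) (erefl (u (to_unit (unit_val t))))) a).
  by exists w => b x' ub bt; subst b; case: x' / ub.
have pv t : p (v t) = u t.
  have ut : u (to_unit (unit_val t)) = u t by rewrite unit_valK.
  apply/union_fibreP; rewrite (vP t _ _ ut) //; exact: set_valP.
have v0 : v zero = y.
  apply: val_inj; rewrite (vP zero 0 x0 (path_to_unit0 u)) ?unit_val0 //.
  by rewrite subpath_cst transport_cst.
have v1 : \val (v one) = \val (transport u a).
  by rewrite (vP one 1 x1 (path_to_unit1 u)) ?unit_val1 // subpath_full.
have vc : continuous v.
  move=> t0 O NO; have [b bt0] := union_point_fibre (v t0).
  have [V [Vadm _ VO]] := sheet_basis (esym bt0)
    (@filterT _ (nbhs (p (v t0))) _) NO.
  have [oV Vt0 _ _] := Vadm.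
  have NV : nbhs (unit_val t0) ((u \o @to_unit R) @^-1` V).
    apply: (continuous_unit_real (v := u)); first exact: cts_fun.
    by rewrite /= unit_valK; apply: open_nbhs_nbhs; rewrite -pv.
  have [e /= e0 eV] := iffLR (nbhs_ballP _ _) NV.
  have Ne : nbhs (unit_val t0) (ball (unit_val t0) e) by exact: nbhsx_ballx.
  apply: filterS (continuous_near (@continuous_unit_val R t0) Ne) => t tt0.
  apply: VO.
  have ut0 : u (to_unit (unit_val t0)) = p (v t0) by rewrite unit_valK pv.
  have ut : u (to_unit (unit_val t)) = u t by rewrite unit_valK.
  exists (u t), (subpath u ut0 ut); split.
    move=> _ [s _ <-]; rewrite subpathE; apply: eV.
    move: tt0; rewrite /ball /=; have /andP[s0 s1] := unit_val_itv s.
    rewrite !ltr_distlC => /andP[h1 h2].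
    by apply/andP; split; nra.
  rewrite (vP t _ _ ut) //; congr \val.
  have -> : b = transport (subpath u (path_to_unit0 u) ut0) a.
    by apply: val_inj; rewrite bt0; exact: vP.
  by rewrite -transport_concat; apply: transport_homotopic;
    exact: path_homotopic_sym (subpath_concat _ _ _).
exists v; last by rewrite v1.
split=> // w [wc w0 pw].
apply: (unit_lift_unique union_has_local_sections) => //.
  by move=> t; rewrite pv pw.
by rewrite v0 w0.
Qed.

End union_space.

End union_spaces.

(** * Associated spaces and functors *)

Section association.
Context (R : realType) (X : topologicalType) (U : Type).
Local Notation I := (unit_interval R).
Local Notation Pi := (fundamental_groupoid R X).
Implicit Types F G : functor Pi (sets U).
Implicit Types Y : space_over X U.

Definition associated Y F : Prop := monodromy_of Y F /\ union_of F Y.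

Definition associated_maps Y1 Y2 F1 F2 (f : map_over Y1 Y2)
    (s : natural_transformation F1 F2) : Prop :=
  forall x (a : fibre F1 x) (y : total_space Y1),
    \val y = \val a -> \val (s x a) = \val (f y).

Lemma associated_maps_total Y1 Y2 F1 F2 (f : map_over Y1 Y2) :
  associated Y1 F1 -> associated Y2 F2 ->
  exists s : natural_transformation F1 F2, associated_maps f s.
Proof.
move=> [mon1 _] [mon2 _].
have s_ex x (a : fibre F1 x) : exists b : fibre F2 x,
    forall y : total_space Y1, \val y = \val a -> \val b = \val (f y).
  have [y ya py] := monodromy_fibre_point a mon1.
  have fyF : \val (f y) \in fibre F2 x.
    by apply/mem_set/(monodromy_fibreP _ _ mon2); rewrite map_proj.
  exists (SigSub fyF) => y' y'a; congr (\val (f _)).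
  by apply: val_inj; rewrite y'a.
pose s' (x : Pi) (a : fibre F1 x) : fibre F2 x := sval (cid (s_ex x a)).
have s'P x (a : fibre F1 x) (y : total_space Y1) :
    \val y = \val a -> \val (s' x a) = \val (f y) := svalP (cid (s_ex x a)) y.
have s'nat (x y : Pi) (c : hom x y) :
    comp (fmap F1 c) (s' y : hom (F1 y) (F2 y)) =
    comp (s' x : hom (F1 x) (F2 x)) (fmap F2 c).
  apply/funext => a; rewrite -(class_reprK c); set u := class_repr c.
  rewrite -[LHS]/(s' y (transport u a)) -[RHS]/(transport (F := F2) u (s' x a)).
  have [w wa _] := monodromy_fibre_point a mon1.
  have [_ /(_ _ _ u a w wa)[v [uv _] va]] := mon1.
  have [vc v0 pv] := uv.
  apply: val_inj; rewrite (s'P _ _ (v one)) //.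
  rewrite (monodromy_transport (y := f w) (v := f \o v) mon2) ?(s'P _ _ w) //.
  split=> [t||t] /=; last by rewrite map_proj pv.
    by apply: continuous_comp; [exact: vc|exact: map_continuous].
  by rewrite v0.
by exists (@NatTrans Pi (sets U) F1 F2 s' s'nat).
Qed.

Lemma associated_maps_surj Y1 Y2 F1 F2 (s : natural_transformation F1 F2) :
  locally_path_connected R X -> semilocally_simply_connected R X ->
  associated Y1 F1 -> associated Y2 F2 ->
  exists f : map_over Y1 Y2, associated_maps f s.
Proof.
move=> X_lpc X_slsc [_ un1] [_ un2].
have /choice[f fP] (y : total_space Y1) : exists w : total_space Y2,
    forall x (a : fibre F1 x), \val y = \val a -> \val (s x a) = \val w.
  have [a ay] := union_point_fibre un1 y.
  have [w wa _] := union_fibre_point un2 (s _ a).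
  exists w => x b yb; rewrite wa.
  have px : projection y = x.
    by apply/(union_fibreP un1); rewrite yb; exact: set_valP.
  by subst x; congr (\val (s _ _)); apply: val_inj; rewrite ay.
have fp y : projection (f y) = projection y.
  have [a ay] := union_point_fibre un1 y.
  by apply/(union_fibreP un2); rewrite -(fP y _ a) //; exact: set_valP.
have fc : continuous f.
  move=> y O NO; have [a ay] := union_point_fibre un1 y.
  have [b by_] : exists b : fibre F2 (projection (f y)), \val b = \val (f y).
    exact: union_point_fibre.
  have [V [Vadm _ VO]] := sheet_basis X_lpc X_slsc un2 (esym by_)
    (@filterT _ (nbhs (projection (f y))) _) NO.
  rewrite fp in b by_ Vadm VO.
  apply: filterS (sheet_nbhs un1 Vadm (esym ay)) => w [z [r [rV wr]]].
  apply: VO; exists z, r; split=> //.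
  rewrite -(fP w z (transport r a)) // natural_transport.
  by congr (\val (transport r _)); apply: val_inj; rewrite by_; exact: fP.
by exists (MapOver fc fp) => x a y ya; exact: fP.
Qed.

Lemma associated_maps_fun Y1 Y2 F1 F2 (f : map_over Y1 Y2)
    (s t : natural_transformation F1 F2) :
  associated Y1 F1 -> associated_maps f s -> associated_maps f t -> s = t.
Proof.
move=> [mon _] fs ft; apply: natural_transformation_eq => x; apply/funext => a.
have [w wa _] := monodromy_fibre_point a mon.
by apply: val_inj; rewrite (fs _ _ w) // (ft _ _ w).
Qed.

Lemma associated_maps_inj Y1 Y2 F1 F2 (f g : map_over Y1 Y2)
    (s : natural_transformation F1 F2) :
  associated Y1 F1 -> associated_maps f s -> associated_maps g s -> f = g.
Proof.
move=> [mon _] fs gs; apply: map_over_eq => y.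
have [a ay] := monodromy_point_fibre y mon.
by apply: val_inj; rewrite -(fs _ a) // -(gs _ a).
Qed.

Lemma associated_maps_comp Y1 Y2 Y3 F1 F2 F3 (f : map_over Y1 Y2)
    (g : map_over Y2 Y3) (s : natural_transformation F1 F2)
    (t : natural_transformation F2 F3) :
  associated_maps f s -> associated_maps g t ->
  associated_maps (map_over_comp f g) (nat_comp s t).
Proof. by move=> fs gt x a y ya; apply: gt; rewrite -(fs x a). Qed.

Section isomorphism.
Context (P : spaces_over X U -> Prop)
  (Q : functor_category Pi (sets U) -> Prop).
Hypothesis X_lpc : locally_path_connected R X.
Hypothesis X_slsc : semilocally_simply_connected R X.
Hypothesis P_Q : forall Y, P Y -> exists2 F, Q F & associated Y F.
Hypothesis Q_P : forall F, Q F -> exists2 Y, P Y & associated Y F.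

Lemma monodromy_union_isomorphism :
  exists (M : functor (full_subcategory P) (full_subcategory Q))
    (E : functor (full_subcategory Q) (full_subcategory P)),
    [/\ is_monodromy_functor M, is_union_functor E & mutually_inverse M E].
Proof.
pose C := full_subcategory P; pose D := full_subcategory Q.
pose RO (Y : C) (F : D) := associated (sval Y) (sval F).
pose RH (Y1 Y2 : C) (F1 F2 : D) (f : hom Y1 Y2) (s : hom F1 F2) :=
  associated_maps (f : map_over (sval Y1) (sval Y2))
    (s : natural_transformation (sval F1) (sval F2)).
have [| | | | | | | | | |M [E [MP M1P EP E1P ME]]] :=
    @correspondence_isomorphism C D RO RH.
- by move=> [Y PY]; have [F QF YF] := P_Q PY; exists (exist _ F QF).
- by move=> [F QF]; have [Y PY YF] := Q_P QF; exists (exist _ Y PY).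
- move=> Y [F QF] [G QG] [/= monF _] [/= monG _].
  have e := monodromy_of_unique monF monG; subst G.
  by rewrite (Prop_irrelevance QF QG).
- move=> [Y PY] [Y' PY'] F [/= _ unY] [/= _ unY'].
  have e := union_of_unique unY unY'; subst Y'.
  by rewrite (Prop_irrelevance PY PY').
- by move=> Y1 Y2 F1 F2 YF1 YF2 f; exact: associated_maps_total.
- by move=> Y1 Y2 F1 F2 YF1 YF2 s; exact: associated_maps_surj.
- move=> Y1 Y2 F1 F2 YF1 _ f s t; exact: associated_maps_fun.
- move=> Y1 Y2 F1 F2 YF1 _ f g s; exact: associated_maps_inj.
- by move=> Y F _ x a y.
- by move=> Y1 Y2 Y3 F1 F2 F3 f g s t _ _ _; exact: associated_maps_comp.
exists M, E; split=> //; split.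
- by move=> Y; case: (MP Y).
- by move=> Y1 Y2 f x a y; exact: M1P.
- by move=> F; case: (EP F).
- move=> F1 F2 s x a y ya; exact/esym/(E1P _ _ s x a).
Qed.

End isomorphism.

Section objects.
Hypothesis X_lpc : locally_path_connected R X.
Hypothesis X_slsc : semilocally_simply_connected R X.

Lemma associated_functor_exists Y :
  continuous (@projection X U Y) -> locally_trivial (@projection X U Y) ->
  exists2 F : functor Pi (sets U), disjoint_values F & associated Y F.
Proof.
move=> pc plt; have Ysec := locally_trivial_sections pc plt.
have [F mon] := monodromy_exists R Ysec.
exists F; last by split=> //; exact: monodromy_union.
move=> x y _ _ [a [Fx Fy]].
have [w wa <-] := monodromy_fibre_point (SigSub (mem_set Fx)) mon.
by apply/(monodromy_fibreP _ _ mon); rewrite wa.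
Qed.

Lemma associated_space_exists F :
  disjoint_values F ->
  exists2 Y,
    continuous (@projection X U Y) /\ locally_trivial (@projection X U Y) &
    associated Y F.
Proof.
move=> dF; have [Y FY] := union_exists X_lpc X_slsc dF.
have pc := union_projection_continuous X_lpc X_slsc FY.
exists Y; last by split=> //; exact: union_monodromy.
split=> //; apply: sections_locally_trivial => //.
exact (union_has_local_sections X_lpc X_slsc FY).
Qed.

Lemma associated_surjective Y F : associated Y F ->
  (forall x, exists y, @projection X U Y y = x) <-> nonempty_values F.
Proof.
move=> [mon _]; split=> [psurj x|ne x].
  by have [y py] := psurj x; exists (\val y); exact/(monodromy_fibreP _ _ mon).
have [a Fa] := ne x.
by have [w _ pw] := monodromy_fibre_point (SigSub (mem_set Fa)) mon; exists w.
Qed.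

End objects.

End association.

Theorem theorem7p8 (R : realType) (X : topologicalType) (U : Type)
    (X_path_connected : path_connected_space R X)
    (X_locally_path_connected : locally_path_connected R X)
    (X_semilocally_simply_connected : semilocally_simply_connected R X) :
  (let Cov := @full_subcategory (spaces_over X U)
     (fun Y => covering_map (@projection X U Y)) in
   let Func := @full_subcategory
     (functor_category (fundamental_groupoid R X) (sets U))
     (fun F => disjoint_values F /\ nonempty_values F) in
   exists (M : functor Cov Func) (E : functor Func Cov),
     [/\ is_monodromy_functor M, is_union_functor E & mutually_inverse M E]) /\
  (let Cov := @full_subcategory (spaces_over X U)
     (fun Y => continuous (@projection X U Y) /\
       locally_trivial (@projection X U Y)) in
   let Func := @full_subcategory
     (functor_category (fundamental_groupoid R X) (sets U))
     (@disjoint_values R X U) in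
   exists (M : functor Cov Func) (E : functor Func Cov),
     [/\ is_monodromy_functor M, is_union_functor E & mutually_inverse M E]).
Proof.
split; apply: monodromy_union_isomorphism => //.
- move=> Y [pc psurj plt].
  have [//|F dF YF] :=
    associated_functor_exists X_locally_path_connected _ pc plt.
  by exists F => //; split=> //; exact/(associated_surjective YF).
- move=> F [dF ne].
  have [//|Y [pc plt] YF] :=
    associated_space_exists X_locally_path_connected _ dF.
  by exists Y => //; split=> //; exact/(associated_surjective YF).
- by move=> Y [pc plt]; exact: associated_functor_exists.
- by move=> F; exact: associated_space_exists.
Qed.
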